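(* Let $X$ be a dendrite, $f:X\to X$ a continuous monotone map and $n\in\mathbb N$. Then the induced map $\mathcal F_n(f):\mathcal F_n(X)\to\mathcal F_n(X)$ has no Li-Yorke pair. In particular, it has zero topological entropy.
   Context: A dendrite is a locally connected continuum (compact connected metric space) containing no simple closed curve. A map is monotone if the preimage of every connected set is connected. $\mathbb N$ denotes the positive integers. $2^X$ is the set of nonempty closed subsets of $X$ with the Hausdorff metric $d_H$; $\mathcal F_n(X)\subset 2^X$ is the family of nonempty subsets of $X$ with at most $n$ points, and $\mathcal F_n(f)(A)=f(A)$. For a continuous self-map $F$ of a compact metric space $(Y,\rho)$, a pair $(x,y)$ is proximal if $\liminf_{k\to\infty}\rho(F^k(x),F^k(y))=0$, asymptotic if $\limsup_{k\to\infty}\rho(F^k(x),F^k(y))=0$, and a Li-Yorke pair if it is proximal but not asymptotic. Topological entropy is $h(F)=\lim_{\varepsilon\to0}\limsup_{m\to\infty}\frac1m\log \mathrm{sep}(m,F,\varepsilon)$, where $\mathrm{sep}(m,F,\varepsilon)$ is the maximal cardinality of a set $E\subset Y$ such that any two distinct $x,y\in E$ satisfy $\rho(F^j(x),F^j(y))>\varepsilon$ for some $0\le j<m$. *)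

(* Defs.v *)
From HB Require Import structures.
From mathcomp Require Import all_boot all_order all_algebra.
From mathcomp Require Import all_classical all_reals all_analysis.

Set Implicit Arguments.
Unset Strict Implicit.
Unset Printing Implicit Defensive.

Import Order.TTheory GRing.Theory Num.Theory.
Import numFieldNormedType.Exports.

Local Open Scope classical_set_scope.
Local Open Scope card_scope.
Local Open Scope ring_scope.

Definition locally_connected (T : topologicalType) : Prop :=
  forall (x : T) (U : set T), nbhs x U ->
    exists V : set T, [/\ open V, connected V, V x & V `<=` U].

Definition unit_circle (R : realType) : set (R * R) :=
  [set p | p.1 ^+ 2 + p.2 ^+ 2 = 1].
Arguments unit_circle : clear implicits.

(** [C] is the image of the circle under a homeomorphism [g] onto [C], with
    inverse [h]; the values of [g] off the circle and of [h] off [C] are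
    irrelevant. *)
Definition simple_closed_curve (R : realType) (T : topologicalType)
    (C : set T) : Prop :=
  exists (g : R * R -> T) (h : T -> R * R),
    [/\ {within unit_circle R, continuous g},
        {within C, continuous h},
        g @` unit_circle R = C &
        {in unit_circle R, cancel g h}].

(** A continuum is nonempty by convention. *)
Definition continuum (T : topologicalType) : Prop :=
  [/\ [set: T] !=set0, compact [set: T] & connected [set: T]].

Definition dendrite (R : realType) (X : metricType R) : Prop :=
  [/\ continuum X, locally_connected X &
      forall C : set X, ~ simple_closed_curve R C].

Definition monotone_map (T U : topologicalType) (f : T -> U) : Prop :=
  forall C : set U, connected C -> connected (f @^-1` C).

Definition enlargement (R : realType) (X : metricType R) (A : set X) (e : R) :
  set X := [set x | exists2 a, A a & mdist a x < e].

Definition hausdorff_dist (R : realType) (X : metricType R) (A B : set X) : R :=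
  inf [set e | [/\ 0 < e, A `<=` enlargement B e & B `<=` enlargement A e]].

Record fin_hyperspace (T : Type) (n : nat) := FinHyperspace {
  fin_set :> set T;
  fin_set_neq0 : fin_set !=set0;
  fin_set_card : fin_set #<= `I_n }.

Lemma fin_set_inj (T : Type) (n : nat) : injective (@fin_set T n).
Proof.
move=> [A A0 An] [B B0 Bn] /= AB; case: _ / AB B0 Bn => B0 Bn.
by congr FinHyperspace; exact: Prop_irrelevance.
Qed.

Lemma fin_set_finite (T : Type) (n : nat) (A : fin_hyperspace T n) :
  finite_set A.
Proof. exact: card_le_finite (fin_set_card A) (finite_II n). Qed.

HB.instance Definition _ (T : Type) (n : nat) :=
  gen_eqMixin (fin_hyperspace T n).
HB.instance Definition _ (T : Type) (n : nat) :=
  gen_choiceMixin (fin_hyperspace T n).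

Section hausdorff_metric.
Variables (R : realType) (X : metricType R) (n : nat).
Implicit Types A B C : fin_hyperspace X n.

Let admissible (A B : set X) : set R :=
  [set e | [/\ 0 < e, A `<=` enlargement B e & B `<=` enlargement A e]].

Lemma admissible_lb (A B : set X) : lbound (admissible A B) 0.
Proof. by move=> e [/ltW]. Qed.

Lemma admissible_neq0 A B : admissible A B !=set0.
Proof.
have /finite_seqP[s As] := fin_set_finite A.
have /finite_seqP[t Bt] := fin_set_finite B.
pose M : R := 1 + \sum_(x <- s) \sum_(y <- t) mdist x y.
have ABM x y : fin_set A x -> fin_set B y -> mdist x y < M.
  rewrite As Bt /= => xs yt.
  rewrite (le_lt_trans (y := \sum_(x <- s) \sum_(y <- t) mdist x y))//.
    rewrite (big_rem x)//= (big_rem y)//= -addrA lerDl addr_ge0//.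
      by apply: sumr_ge0 => *; exact: mdist_ge0.
    by apply: sumr_ge0 => *; apply: sumr_ge0 => *; exact: mdist_ge0.
  by rewrite ltrDr.
have [a Aa] := fin_set_neq0 A; have [b Bb] := fin_set_neq0 B.
exists M; split.
- exact: le_lt_trans (mdist_ge0 _ _) (ABM _ _ Aa Bb).
- by move=> x Ax; exists b => //; rewrite metric_sym ABM.
- by move=> y By; exists a => //; rewrite ABM.
Qed.

Lemma hausdorff_dist_lt A B (e : R) : hausdorff_dist A B < e ->
  A `<=` enlargement B e /\ B `<=` enlargement A e.
Proof.
move=> /(inf_lt (admissible_neq0 A B))[d [d0 AB BA] de]; split=> x.
  by move=> /AB[b Bb bx]; exists b => //; exact: lt_trans de.
by move=> /BA[b Bb bx]; exists b => //; exact: lt_trans de.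
Qed.

Lemma hausdorff_dist_le A B (e : R) : 0 < e ->
  A `<=` enlargement B e -> B `<=` enlargement A e -> hausdorff_dist A B <= e.
Proof.
by move=> e0 AB BA; apply: ge_inf; [exists 0; exact: admissible_lb|split].
Qed.

Let hausdorff_distxx A : hausdorff_dist A A = 0.
Proof.
apply/eqP; rewrite eq_le; apply/andP; split.
  apply/ler_addgt0Pl => e e0; rewrite addr0.
  by apply: hausdorff_dist_le => // x Ax; exists x => //; rewrite mdistxx.
by apply: lb_le_inf; [exact: admissible_neq0|exact: admissible_lb].
Qed.

Let hausdorff_dist_sym A B : hausdorff_dist A B = hausdorff_dist B A.
Proof. by congr inf; apply/seteqP; split=> e [? ? ?]; split. Qed.

Let hausdorff_dist0_sub A B : hausdorff_dist A B = 0 -> A `<=` B.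
Proof.
move=> AB0 x Ax.
have -> : fin_set B = closure B.
  apply/closure_id; apply: (accessible_finite_set_closed.1 _) (fin_set_finite B).
  exact/hausdorff_accessible/metric_hausdorff.
move=> U /nbhs_ballP[e /= e0 xU].
have [/(_ _ Ax)[b Bb bx] _] : A `<=` enlargement B e /\ B `<=` enlargement A e.
  by apply: hausdorff_dist_lt; rewrite AB0.
by exists b; split=> //; apply: xU; rewrite ballEmdist /= metric_sym.
Qed.

Let hausdorff_dist_positivity A B : hausdorff_dist A B = 0 -> A = B.
Proof.
move=> AB0; apply: fin_set_inj; apply/seteqP; split.
  exact: hausdorff_dist0_sub.
by apply: hausdorff_dist0_sub; rewrite hausdorff_dist_sym.
Qed.

Let enlargement_trans (A B C : set X) (d e : R) :
  A `<=` enlargement B d -> B `<=` enlargement C e ->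
  A `<=` enlargement C (e + d).
Proof.
move=> AB BC x /AB[b /BC[c Cc cb] bx]; exists c => //.
by apply: le_lt_trans (metric_triangle c b x) _; exact: ltrD.
Qed.

Let hausdorff_dist_triangle B A C :
  hausdorff_dist A C <= hausdorff_dist A B + hausdorff_dist B C.
Proof.
apply/ler_addgt0Pr => e e0; rewrite [in leRHS](splitr e) addrACA.
have e2 : 0 < e / 2 by rewrite divr_gt0.
have dge0 (D E : fin_hyperspace X n) : 0 <= hausdorff_dist D E.
  by apply: lb_le_inf; [exact: admissible_neq0|exact: admissible_lb].
have [|AB BA] := @hausdorff_dist_lt A B (hausdorff_dist A B + e / 2).
  by rewrite ltrDl.
have [|BC CB] := @hausdorff_dist_lt B C (hausdorff_dist B C + e / 2).
  by rewrite ltrDl.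
apply: hausdorff_dist_le; first by rewrite addr_gt0// ltr_wpDl.
  by rewrite addrC; exact: enlargement_trans AB BC.
exact: enlargement_trans CB BA.
Qed.

HB.instance Definition _ := @isMetric.Build R (fin_hyperspace X n)
  (fun A B => hausdorff_dist A B) hausdorff_distxx hausdorff_dist_positivity
  hausdorff_dist_sym hausdorff_dist_triangle.

End hausdorff_metric.

Lemma fin_hyperspace_mdistE (R : realType) (X : metricType R) (n : nat)
  (A B : fin_hyperspace X n) : mdist A B = hausdorff_dist A B.
Proof. by []. Qed.

Definition fin_hyperspace_map (T U : Type) (n : nat) (f : T -> U)
    (A : fin_hyperspace T n) : fin_hyperspace U n :=
  FinHyperspace (image_nonempty f (fin_set_neq0 A))
    (card_le_trans (card_image_le f A) (fin_set_card A)).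
Arguments fin_hyperspace_map {T U} n f A.

Section dynamics.
Variables (R : realType) (Y : metricType R) (F : Y -> Y).

Definition orbit_dist (x y : Y) (k : nat) : \bar R :=
  (mdist (iter k F x) (iter k F y))%:E.

Definition proximal_pair (x y : Y) : Prop := limn_einf (orbit_dist x y) = 0%E.

Definition asymptotic_pair (x y : Y) : Prop := limn_esup (orbit_dist x y) = 0%E.

Definition li_yorke_pair (x y : Y) : Prop :=
  proximal_pair x y /\ ~ asymptotic_pair x y.

Definition separated_set (m : nat) (e : R) (E : set Y) : Prop :=
  forall x y, E x -> E y -> x <> y ->
    exists2 j, (j < m)%N & e < mdist (iter j F x) (iter j F y).

Definition max_separated (m : nat) (e : R) : \bar R :=
  ereal_sup [set (k%:R)%:E | k in
    [set k : nat | exists2 E : set Y, separated_set m e E & E #= `I_k]].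

(** The term of index [m = 0] is irrelevant to the upper limit. *)
Definition entropy_at_scale (e : R) : \bar R :=
  limn_esup (fun m : nat => ((m%:R)^-1%:E * lne (max_separated m e))%E).

Definition topological_entropy : \bar R :=
  lim (entropy_at_scale e @[e --> 0^'+]).

Lemma max_separated_le (m : nat) (d e : R) : d <= e ->
  (max_separated m e <= max_separated m d)%E.
Proof.
move=> de; apply: ge_ereal_sup => _ [k [E sepE Ek] <-].
apply: ereal_sup_ubound; exists k => //; exists E => // x y Ex Ey xy.
by have [j jm] := sepE _ _ Ex Ey xy; exists j => //; exact: le_lt_trans de _.
Qed.

Lemma max_separated_ge0 (m : nat) (e : R) : (0 <= max_separated m e)%E.
Proof.
apply: ereal_sup_ubound; exists 0%N => //; exists set0 => //.
by rewrite II0 card_eq0.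
Qed.

Lemma entropy_at_scale_le (d e : R) : d <= e ->
  (entropy_at_scale e <= entropy_at_scale d)%E.
Proof.
move=> de; rewrite /entropy_at_scale !limn_esup_lim.
apply: lee_lim; [exact: is_cvg_esups|exact: is_cvg_esups|].
apply: nearW => N; apply: ge_ereal_sup => _ [m /= Nm <-].
apply: le_trans (ereal_sup_ubound _); last by exists m; [exact: Nm|reflexivity].
apply: lee_wpmul2l; first by rewrite lee_fin invr_ge0.
by rewrite lee_lne ?max_separated_le// in_itv /= max_separated_ge0 leey.
Qed.

Lemma topological_entropy_cvg :
  entropy_at_scale e @[e --> 0^'+] --> topological_entropy.
Proof.
apply: nonincreasing_at_right_is_cvge; near=> b => x y _ _.
exact: entropy_at_scale_le.
Unshelve. all: by end_near. Qed.

End dynamics.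

(* Main.v *)
Require Import Defs.
From HB Require Import structures.
From mathcomp Require Import all_boot all_order all_algebra.
From mathcomp Require Import all_classical all_reals all_analysis.
From mathcomp Require Import lra.
Import Order.TTheory GRing.Theory Num.Theory.
Import numFieldNormedType.Exports.

Set Implicit Arguments.
Unset Strict Implicit.
Unset Printing Implicit Defensive.

Local Open Scope classical_set_scope.
Local Open Scope ring_scope.

(** Call an open connected set with connected complement a halfspace.  In a
    dendrite distinct points lie in the interiors of complementary halfspaces,
    so by compactness finitely many halfspaces separate all points at distance
    at least [e].  A halfspace has a single boundary point, hence two
    halfspaces never cross: one of the four intersections of them and their
    complements is empty.  Preimages of halfspaces under a continuous monotone
    map are halfspaces.

    Absence of Li-Yorke pairs: let [u k] tell whether [f^k x] lies in the
    halfspace [C].  Since [C] and [f^-q C] do not cross, for every lag [q] some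
    pattern [(u k, u (k + q))] never occurs, and this forces [u] to be
    eventually periodic.  Therefore every orbit is, up to [e], eventually
    periodic; finitely many orbits have a common period, so finite sets that
    come close once stay close.

    Zero entropy: [N] pairwise noncrossing sets cut a space into at most [N + 1]
    pieces, so the itineraries of length [m] grow linearly in [m] and the
    [(m, e)]-separated sets of the induced map polynomially.

    The topological input is that points [x <> y] are separated by a point of
    an arc joining them, since otherwise a second arc would create a simple
    closed curve.  Arcs come from paths, built by refining chains of small
    connected open sets, then erasing loops (Zorn) and reparametrising. *)

(** * Paths in connected open sets *)

(** The closure condition keeps limits of nested pieces inside [V]; the bound on the diameter makes
    such limits unique. *)
Definition piece (R : realType) (X : metricType R) (V : set X) (e : R)
    (W : set X) : Prop :=
  [/\ open W, connected W, closure W `<=` V &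
      forall a b, W a -> W b -> mdist a b <= e].

Lemma nbhs_mdist (R : realType) (X : metricType R) (x : X) (U : set X) :
  nbhs x U -> exists2 e, 0 < e & forall y, mdist x y < e -> U y.
Proof.
by move=> /nbhs_ballP[e /= e0 xU]; exists e => // y xy; apply: xU; rewrite ballEmdist.
Qed.

Lemma mdist_nbhs (R : realType) (X : metricType R) (x : X) (e : R) :
  0 < e -> nbhs x [set y | mdist x y < e].
Proof. by move=> e0; rewrite -ballEmdist; exact: nbhsx_ballx. Qed.

Lemma closure_mdist (R : realType) (X : metricType R) (A : set X) (x : X)
  (e : R) : closure A x -> 0 < e -> exists2 y, A y & mdist x y < e.
Proof. by move=> + /(mdist_nbhs x) => /[apply] -[y []]; exists y. Qed.

Lemma piece_exists (R : realType) (X : metricType R) (V : set X) (e : R)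
    (x : X) :
  locally_connected X -> open V -> V x -> 0 < e ->
  exists2 W, piece V e W & W x.
Proof.
move=> lcX oV Vx e0.
have [d d0 dV] := nbhs_mdist (open_nbhs_nbhs (conj oV Vx)).
pose r := Num.min d e / 2.
have r0 : 0 < r by rewrite divr_gt0// lt_min d0.
have rd : r <= d / 2 by rewrite ler_pM2r// ge_min lexx.
have re : r <= e / 2 by rewrite ler_pM2r// ge_min lexx orbT.
have [W [oW cW Wx Wr]] := lcX _ _ (mdist_nbhs x r0).
exists W => //; split => // [z|a b /Wr /= xa /Wr /= xb].
  move=> /closure_mdist/(_ r0)[w /Wr /= xw zw]; apply: dV.
  by have := metric_triangle x w z; rewrite (metric_sym w z); lra.
by have := metric_triangle a x b; rewrite (metric_sym a x); lra.
Qed.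

(* The index set is all of [nat], constant from [N] on, so that chains of
   different lengths can be padded to a common one. *)
Definition chain (R : realType) (X : metricType R) (V : set X) (e : R)
    (p q : X) (N : nat) (c : nat -> X) (W : nat -> set X) : Prop :=
  [/\ c 0%N = p, forall j, (N <= j)%N -> c j = q &
      forall j, [/\ piece V e (W j), W j (c j) & W j (c j.+1)]].

Lemma chain_extend (R : realType) (X : metricType R) (V : set X) (e : R)
    (p q r : X) (U : set X) N c W :
  piece V e U -> U q -> U r -> chain V e p q N c W ->
  exists N' c' W', chain V e p r N' c' W'.
Proof.
move=> pU Uq Ur [c0 cN cW].
exists N.+1, (fun j => if (j <= N)%N then c j else r),
  (fun j => if (j < N)%N then W j else U); split => // [j|j].
  by rewrite ltnNge => /negbTE ->.
have [jN|Nj] := ltnP j N; first by rewrite ltnW.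
split=> //.
have [jN|//] := leqP j N.
by rewrite cN.
Qed.

(** A piece is reached by chains from [p] either entirely or not at all, so the reachable points
    form a relatively open and closed subset of the connected set [V]. *)
Lemma chain_exists (R : realType) (X : metricType R) (V : set X) (e : R)
    (p q : X) :
  locally_connected X -> open V -> connected V -> V p -> V q -> 0 < e ->
  exists N c W, chain V e p q N c W.
Proof.
move=> lcX oV cV Vp Vq e0.
pose reach z := exists N c W, chain V e p z N c W.
have reachE U z w : piece V e U -> U z -> U w -> reach z -> reach w.
  by move=> pU Uz Uw [N [c [W zc]]]; exact: chain_extend pU Uz Uw zc.
suff VE : [set z | V z /\ reach z] = V.
  by have [] : [set z | V z /\ reach z] q by rewrite VE.
apply: cV.
- exists p; split => //; have [W pW Wp] := piece_exists lcX oV Vp e0.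
  by exists 0%N, (fun=> p), (fun=> W); split.
- exists [set z | V z /\ reach z]; last first.
    by apply/seteqP; split => [z [Vz rz]|z [Vz [_ rz]]].
  rewrite openE => z [Vz rz]; have [W pW Wz] := piece_exists lcX oV Vz e0.
  have [oW _ clWV _] := pW; rewrite /interior.
  apply: filterS (open_nbhs_nbhs (conj oW Wz)) => w Ww; split.
    exact/clWV/subset_closure.
  exact: reachE pW Wz Ww rz.
- exists (~` [set z | V z /\ ~ reach z]).
    apply: open_closedC; rewrite openE => z [Vz rz].
    have [W pW Wz] := piece_exists lcX oV Vz e0.
    have [oW _ clWV _] := pW; rewrite /interior.
    apply: filterS (open_nbhs_nbhs (conj oW Wz)) => w Ww; split.
      exact/clWV/subset_closure.
    by move=> rw; apply: rz; exact: reachE pW Ww Wz rw.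
  apply/seteqP; split => [z [Vz rz]|z [Vz rz]]; split => //; first by case.
  by apply: contrapT => nrz; apply: rz.
Qed.

Record subdivision (X : Type) := Subdivision {
  sd_size : nat; sd_point : nat -> X; sd_cell : nat -> set X }.

Definition subdivision_path (R : realType) (X : metricType R) (V : set X)
    (p q : X) (e : R) (s : subdivision X) : Prop :=
  [/\ (0 < sd_size s)%N, sd_point s 0 = p, sd_point s (sd_size s) = q &
    forall i, (i < sd_size s)%N ->
      [/\ piece V e (sd_cell s i), sd_cell s i (sd_point s i) &
          sd_cell s i (sd_point s i.+1)]].

(** All cells are split into the same number [L] of cells, so that passing from a fine index to the
    coarse one is division by [L]. *)
Definition refines (X : Type) (s t : subdivision X) : Prop :=
  exists L, [/\ (0 < L)%N, sd_size t = (sd_size s * L)%N &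
    forall k, (k < sd_size t)%N -> sd_cell t k `<=` sd_cell s (k %/ L)%N].

(** Each cell is open and connected, so a chain of finer pieces inside it joins its two division
    points; these chains are padded to a common length and concatenated. *)
Lemma refinement_exists (R : realType) (X : metricType R) (V : set X)
    (p q : X) (d e : R) (s : subdivision X) :
  locally_connected X -> 0 < e -> subdivision_path V p q d s ->
  exists2 t, subdivision_path V p q e t & refines s t.
Proof.
move=> lcX e0; case: s => M c W [/= M0 c0 cM cW].
have /choice[T chT] i : exists T : nat * (nat -> X) * (nat -> set X),
    (i < M)%N -> chain (W i) e (c i) (c i.+1) T.1.1 T.1.2 T.2.
  have [iM|_] := ltnP i M; last by exists (0%N, c, W).
  have [[oW cnW _ _] Wi Wi1] := cW _ iM.
  have [N [c' [W' ch]]] := chain_exists lcX oW cnW Wi Wi1 e0.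
  by exists (N, c', W').
(* Every chain has arrived at its end by index [L]; the successor keeps [L] positive even when all
   chains are constant. *)
pose L := (\max_(i < M) (T i).1.1).+1.
have LT i : (i < M)%N -> ((T i).1.1 < L)%N.
  by move=> iM; rewrite ltnS; exact: (leq_bigmax (Ordinal iM)).
have cellP k : (k < M * L)%N -> (k %/ L < M)%N by move=> kML; rewrite ltn_divLR.
pose c' k := if (k < M * L)%N then (T (k %/ L)%N).1.2 (k %% L)%N else q.
pose W' k := (T (k %/ L)%N).2 (k %% L)%N.
have pW' k : (k < M * L)%N -> piece (W (k %/ L)%N) e (W' k).
  by move=> /cellP/chT[_ _ /(_ (k %% L)%N)[]].
exists (Subdivision (M * L) c' W'); last first.
  exists L; split => //= k /pW'[_ _ clW _].
  exact: subset_trans (@subset_closure _ _) clW.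
split => //=.
- by rewrite muln_gt0 M0.
- rewrite /c' muln_gt0 M0/= div0n mod0n.
  by have [-> _ _] := chT _ M0.
- by rewrite /c' ltnn.
move=> k kML; have kM := cellP _ kML.
have [_ cT chk] := chT _ kM; have [_ W'k W'k1] := chk (k %% L)%N.
split.
- have [oW cnW clW diW] := pW' _ kML; split => //.
  have [[_ _ clV _] _ _] := cW _ kM.
  by apply: subset_trans clW _; apply: subset_trans clV; exact: subset_closure.
- by rewrite /c' kML.
(* Inside a block this is the next point of the same chain. At the end of a block the index jumps to
   the next chain, whose first point is the last point of this one. *)
- suff -> : c' k.+1 = (T (k %/ L)%N).1.2 (k %% L).+1 by [].
  have := ltn_pmod k (ltn0Sn (\max_(i < M) (T i).1.1)).
  rewrite -/L leq_eqVlt => /predU1P[kL|kL]; last first.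
    have kE : k.+1 = (k %/ L * L + (k %% L).+1)%N by rewrite addnS -divn_eq.
    have -> : c' k.+1 = if (k.+1 < M * L)%N then
      (T (k.+1 %/ L)%N).1.2 (k.+1 %% L)%N else q by [].
    have -> : (k.+1 %/ L = k %/ L)%N by rewrite kE divnMDl// (divn_small kL) addn0.
    have -> : (k.+1 %% L = (k %% L).+1)%N by rewrite [in LHS]kE modnMDl (modn_small kL).
    case: ifPn => //; rewrite -leqNgt => MLk.
    have : (k.+1 < (k %/ L).+1 * L)%N by rewrite kE mulSn addnC ltn_add2r.
    move=> /leq_trans /(_ (leq_mul kM (leqnn L))).
    by rewrite ltnNge MLk.
  have kE : k.+1 = ((k %/ L).+1 * L)%N.
    by rewrite [in LHS](divn_eq k L) -addnS kL mulSn addnC.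
  rewrite kL (cT L); last by rewrite ltnW// LT.
  rewrite /c' kE ltn_pmul2r// mulnK// modnMl.
  case: ltnP => [/chT[->]//|Mk]; rewrite -cM; congr c.
  by apply/eqP; rewrite eqn_leq Mk.
Qed.

Lemma truncn_divn (R : archiRealFieldType) (x : R) (L : nat) : (0 < L)%N ->
  (Num.truncn (x * L%:R) %/ L)%N = Num.truncn x.
Proof.
move=> L0; have L0' : 0 < L%:R :> R by rewrite ltr0n.
have [x0|x0] := leP 0 x; last first.
  rewrite !(truncn_floor _) !leNgt pmulr_llt0// x0/=.
  by rewrite div0n.
have /andP[mx xm] := truncn_itv x0.
have xL0 : 0 <= x * L%:R by rewrite mulr_ge0// ltW.
have /andP[kx xk] := truncn_itv xL0.
apply/eqP; rewrite eqn_leq -ltnS ltn_divLR// leq_divRL//.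
rewrite -(ltr_nat R) -(ltnS (_ * _)) -(ltr_nat R) !natrM; apply/andP; split.
  by apply: le_lt_trans kx _; rewrite ltr_pM2r.
by apply: le_lt_trans xk; rewrite ler_pM2r.
Qed.

Lemma truncn_near (R : archiRealFieldType) (x y : R) : `|x - y| < 1 ->
  (Num.truncn x <= (Num.truncn y).+1)%N.
Proof.
rewrite ltr_norml => /andP[_ xy]; rewrite truncn_le_nat.
have := truncnS_gt y; rewrite -[in X in _ -> X]addn1 natrD; lra.
Qed.

(** Repeated refinement assigns to a time [t] a decreasing sequence of cells [C n t] with diameters
    tending to 0; [g t] is the common point of their closures. Close times have equal or adjacent
    indices at level [n], and adjacent cells share a division point, whence continuity. *)
Lemma path_exists (R : realType) (X : metricType R) (V : set X) (p q : X) :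
  compact [set: X] -> locally_connected X -> open V -> connected V ->
  V p -> V q ->
  exists g : R -> X, [/\ continuous g, g 0 = p, g 1 = q & forall t, V (g t)].
Proof.
move=> cptX lcX oV cV Vp Vq.
pose eps n : R := n.+1%:R^-1.
have eps0 n : 0 < eps n by rewrite invr_gt0 ltr0n.
have [s0 s0P] : exists s, subdivision_path V p q (eps 0) s.
  have [N [c [W [c0 cN cW]]]] := chain_exists lcX oV cV Vp Vq (eps0 0).
  exists (Subdivision N.+1 c W); split => //=.
  by rewrite cN.
have /choice[nxt nxtP] (ns : nat * subdivision X) : exists t,
    subdivision_path V p q (eps ns.1) ns.2 ->
    subdivision_path V p q (eps ns.1.+1) t /\ refines ns.2 t.
  have [nsP|?] := pselect (subdivision_path V p q (eps ns.1) ns.2); last first.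
    by exists s0.
  by have [t] := refinement_exists lcX (eps0 ns.1.+1) nsP; exists t.
pose s := fix s n := if n is m.+1 then nxt (m, s m) else s0.
have sP n : subdivision_path V p q (eps n) (s n).
  by elim: n => // n /(nxtP (n, s n))[].
have sS n : refines (s n) (s n.+1) by have [] := nxtP (n, s n) (sP n).
pose M n := sd_size (s n).
have M0 n : (0 < M n)%N by have [] := sP n.
(* The cap sends [t = 1] and all later times to the last cell; truncation sends negative times to
   cell 0. *)
pose idx n (t : R) := minn (Num.truncn (t * (M n)%:R)) (M n).-1.
have idxM n t : (idx n t < M n)%N by rewrite (leq_ltn_trans (geq_minr _ _))// prednK.
pose C n t := sd_cell (s n) (idx n t).
pose P n t := sd_point (s n) (idx n t).
have CP n t : C n t (P n t) by have [_ _ _ /(_ _ (idxM n t))[]] := sP n.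
have CS n t : C n.+1 t `<=` C n t.
  have [L [L0 ML /(_ _ (idxM n.+1 t))]] := sS n.
  suff -> : (idx n.+1 t %/ L = idx n t)%N by [].
  rewrite /idx [M n.+1]ML natrM mulrA -(truncn_divn (t * _) L0).
  set k := Num.truncn _; rewrite -!/(M _).
  have MLE : ((M n * L).-1 %/ L = (M n).-1)%N.
    have -> : (M n * L).-1 = ((M n).-1 * L + L.-1)%N.
      by rewrite -{1}(prednK (M0 n)) mulSn addnC -(prednK L0) addnS.
    by rewrite divnMDl// divn_small ?prednK// addn0.
  have [kM|kM] := leqP k (M n * L).-1.
    by apply/esym/minn_idPl; rewrite -MLE leq_div2r.
  rewrite MLE; apply/esym/minn_idPr.
  by rewrite -MLE leq_div2r// ltnW.
have CmS m n t : (m <= n)%N -> C n t `<=` C m t.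
  elim: n => [|n IH]; first by rewrite leqn0 => /eqP ->.
  rewrite leq_eqVlt => /predU1P[-> //|/IH]; exact: subset_trans.
(* By compactness the points [P n t] cluster somewhere, and a cluster point lies in every closure
   since the cells are nested. *)
have /choice[g gP] t : exists z, forall n, closure (C n t) z.
  have [|z [_ zP]] := cptX ((P^~ t) @ \oo) _; first exact: filterT.
  exists z => n U /zP; apply.
  by exists n => // k /= nk; apply: (CmS _ _ _ nk).
have Cdiam n t z w : closure (C n t) z -> C n t w -> mdist w z <= eps n.
  have [_ _ _ /(_ _ (idxM n t))[[_ _ _ dC] _ _]] := sP n.
  move=> Cz Cw; apply/ler_addgt0Pr => d d0.
  have [y Cy zy] := closure_mdist Cz d0.
  rewrite (le_trans (metric_triangle w y z))// lerD ?dC// metric_sym.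
  exact: ltW.
have small (z w : X) : (forall n, mdist w z <= eps n) -> w = z.
  move=> H; apply: mdist_positivity; apply/eqP; rewrite eq_le mdist_ge0 andbT.
  apply/ler_addgt0Pr => e e0; rewrite add0r.
  have [n _ /(_ n (leqnn n)) /= ne] := near_infty_natSinv_lt (PosNum e0).
  exact: le_trans (H n) (ltW ne).
exists g; split.
- move=> t; apply/metricType_numDomainType.cvgrPdist_lt => e e0.
  have e20 : 0 < e / 2 by rewrite divr_gt0.
  have [n _ /(_ n (leqnn n)) /= ne] := near_infty_natSinv_lt (PosNum e20).
  have : nbhs t [set u | `|t - u| < (M n)%:R^-1].
    by apply: (nbhsx_ballx t (M n)%:R^-1); rewrite invr_gt0 ltr0n.
  apply: filterS => u /= tu.
  have Mn0 : 0 < (M n)%:R :> R by rewrite ltr0n.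
  have tuM a b : `|a - b| < (M n)%:R^-1 -> (idx n a <= (idx n b).+1)%N.
    move=> ab; have := @truncn_near _ (a * (M n)%:R) (b * (M n)%:R).
    rewrite -mulrBl normrM (gtr0_norm Mn0) -ltr_pdivlMr// mul1r => /(_ ab).
    by move=> H; rewrite /idx -minnSS leq_min !geq_min H leqnSn orbT.
  wlog idxtu : t u tu / (idx n t <= idx n u)%N => [hw|].
    have [|/ltnW ut] := leqP (idx n t) (idx n u); first exact: hw.
    by rewrite metric_sym hw// distrC.
  have d z : C n t z -> C n u z -> mdist (g t) (g u) < e.
    move=> tz uz; rewrite (le_lt_trans (metric_triangle _ z _))//.
    rewrite (splitr e) ltrD// (le_lt_trans _ ne)//.
      by rewrite metric_sym; exact: Cdiam (gP t n) tz.
    exact: Cdiam (gP u n) uz.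
  have := tuM u t; rewrite distrC => /(_ tu).
  rewrite leq_eqVlt => /predU1P[utE|]; last first.
    rewrite ltnS => ut; have idxE : idx n t = idx n u.
      by apply/eqP; rewrite eqn_leq idxtu.
    by apply: (d (P n t)) => //; rewrite /C -idxE; exact: CP.
  have [_ _ _ sPn] := sP n.
  apply: (d (sd_point (s n) (idx n u))); last exact: CP.
  by rewrite utE; have [] := sPn _ (idxM n t).
- apply/esym/small => n; apply: Cdiam (gP _ _) _.
  have i0 : idx n 0 = 0%N by rewrite /idx mul0r truncn0 min0n.
  by have [_ <- _ _] := sP n; rewrite -i0; exact: CP.
- apply/esym/small => n; apply: Cdiam (gP _ _) _.
  have i1 : idx n 1 = (M n).-1.
    by rewrite /idx mul1r natrK; apply/minn_idPr; exact: leq_pred.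
  have [_ _ <- sPn] := sP n.
  have [_ _] := sPn _ (idxM n 1); rewrite /C i1.
  by rewrite -/(M n) prednK.
- move=> t; have [_ _ _ /(_ _ (idxM 0 t))[[_ _ clV _] _ _]] := sP 0%N.
  exact/clV/gP.
Qed.

(** * Loop erasure and arcs *)

(** A finite subcover taken from a chain has a largest member. In filter form: the tails of the
    chain [F] form a filter, to which near-covering compactness applies. *)
Lemma compact_chain_cover (T : topologicalType) (K : set T) (F : set (set T)) :
  compact K -> (forall U, F U -> open U) -> total_on F subset -> F !=set0 ->
  K `<=` \bigcup_(U in F) U -> exists2 U, F U & K `<=` U.
Proof.
move=> /compact_near_coveringP cK oF totF [U0 FU0] KF.
pose G := filter_from F (fun U => [set V | F V /\ U `<=` V]).
have GF : Filter G.
  apply: filter_from_filter; first by exists U0.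
  move=> U V FU FV; have [UV|VU] := totF _ _ FU FV.
    exists V => // W [FW VW]; split; split => //; exact: subset_trans VW.
  exists U => // W [FW UW]; split; split => //; exact: subset_trans UW.
have [|U FU UK] := cK _ G (fun V x => V x) GF.
  move=> x /KF[U FU Ux]; exists (U, [set V | F V /\ U `<=` V]) => /=.
    split; last by exists U.
    by apply: open_nbhs_nbhs; split => //; exact: oF.
  by move=> [y V] /= [Uy [_]]; exact.
by exists U => //; apply: (UK U); split.
Qed.

Lemma closed_max (R : realType) (A : set R) (u v : R) : closed A -> A u ->
  u <= v -> exists m, [/\ A m, u <= m <= v & forall w, A w -> w <= v -> w <= m].
Proof.
move=> cA Au uv.
have [|||m /set_mem [Am /= /[!in_itv]/= umv] mmax] :=
  @compact_EVT_max _ R id (A `&` `[u, v]).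
- by exists u; split => //=; rewrite in_itv/= lexx uv.
- by rewrite setIC; apply: compact_closedI => //; exact: segment_compact.
- by apply: continuous_subspaceT => ?; exact: cvg_id.
exists m; split => // w Aw wv.
have [uw|/ltW wu] := leP u w; last by rewrite (le_trans wu)//; case/andP: umv.
by apply: mmax; rewrite inE; split => //=; rewrite in_itv/= uw.
Qed.

Lemma closed_min (R : realType) (A : set R) (u v : R) : closed A -> A v ->
  u <= v -> exists m, [/\ A m, u <= m <= v & forall w, A w -> u <= w -> m <= w].
Proof.
move=> cA Av uv.
have [|||m /set_mem [Am /= /[!in_itv]/= umv] mmin] :=
  @compact_EVT_min _ R id (A `&` `[u, v]).
- by exists v; split => //=; rewrite in_itv/= lexx uv.
- by rewrite setIC; apply: compact_closedI => //; exact: segment_compact.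
- by apply: continuous_subspaceT => ?; exact: cvg_id.
exists m; split => // w Aw uw.
have [wv|/ltW vw] := leP w v; last by rewrite (le_trans _ vw)//; case/andP: umv.
by apply: mmin; rewrite inE; split => //=; rewrite in_itv/= uw.
Qed.

(* Across each gap of [A] the path [g] returns to the same point, so skipping
   the gaps leaves a path. *)
Definition loop_erasing (R : realType) (T : Type) (g : R -> T) (A : set R) :
    Prop :=
  [/\ closed A, A 0, A 1 & forall s t, A s -> A t -> s < t ->
    (forall u, A u -> u <= s \/ t <= u) -> g s = g t].

(** Zorn's lemma is applied to the complements, so a chain has to be closed under union. A gap of
    the resulting intersection is, up to small ends, already inside a gap of one member by
    compactness, and continuity of [g] makes the values at the two ends agree. *)
Lemma loop_erasing_min (R : realType) (X : metricType R) (g : R -> X) :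
  continuous g ->
  exists2 A, loop_erasing g A &
    forall B, loop_erasing g B -> B `<=` A -> B = A.
Proof.
move=> cg.
have [F FP totF|U [AU Umax]] := @Zorn_bigcup R [set U | loop_erasing g (~` U)];
    last first.
  exists (~` U) => // B gB BU; apply: contrapT => BneU.
  apply: (Umax (~` B)); last by rewrite /= setCK.
  split; first by move=> x Ux Bx; exact: (BU x Bx).
  move=> BU'; apply: BneU; apply/seteqP; split => // x Ux.
  by apply: contrapT => Bx; exact: (Ux (BU' _ Bx)).
split.
- rewrite setC_bigcup; apply: closed_bigI => U /FP[]//.
- by move=> [U /FP[_ + _ _]].
- by move=> [U /FP[_ _ + _]].
move=> s t As At st gap.
apply: mdist_positivity; apply/eqP; rewrite eq_le mdist_ge0 andbT.
apply/ler_addgt0Pr => e e0; rewrite add0r.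
have e20 : 0 < e / 2 by rewrite divr_gt0.
have near_g w : exists2 d, 0 < d &
    forall u, `|w - u| < d -> mdist (g w) (g u) < e / 2.
  have /metricType_numDomainType.cvgrPdist_lt/(_ _ e20) := cg w.
  by move=> /nbhs_ballP[d /= d0 wd]; exists d => // u; exact: wd.
have [d1 d10 gs] := near_g s; have [d2 d20 gt] := near_g t.
(* Below [d1] and [d2], to stay where [g] is close to [g s] and [g t]; at most a third of [t - s],
   to keep [s + d] before [t - d]. *)
pose d := Num.min (Num.min d1 d2) (t - s) / 3.
have d0 : 0 < d by rewrite divr_gt0// !lt_min d10 d20 subr_gt0.
have dd1 : d < d1.
  rewrite ltr_pdivrMr// (le_lt_trans (y := d1))//; last by lra.
  by rewrite !ge_min lexx.
have dd2 : d < d2.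
  rewrite ltr_pdivrMr// (le_lt_trans (y := d2))//; last by lra.
  by rewrite !ge_min lexx orbT.
have dts : d <= (t - s) / 3 by rewrite ler_pM2r// ge_min lexx orbT.
have inF u : s < u < t -> (\bigcup_(U in F) U) u.
  move=> /andP[su ut]; apply: contrapT => Au.
  by have [] := gap _ Au; lra.
have [U FU KU] : exists2 U, F U & `[s + d, t - d] `<=` U.
  apply: compact_chain_cover => //.
  - exact: segment_compact.
  - by move=> U /FP[cU _ _ _]; rewrite -(setCK U); exact: closed_openC.
  - by have [|U FU _] := inF ((s + t) / 2); [apply/andP; split; lra|exists U].
  - by move=> u; rewrite /= in_itv/= => /andP[? ?]; apply: inF; apply/andP; split; lra.
have [cU _ _ gapU] := FP _ FU.
have Us : (~` U) s by move=> Us; apply: As; exists U.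
have Ut : (~` U) t by move=> Ut; apply: At; exists U.
have sd : s <= s + d by rewrite lerDl ltW.
have dt : t - d <= t by rewrite gerBl ltW.
have [a [Ua /andP[sa ad] amax]] := closed_max cU Us sd.
have [b [Ub /andP[db bt] bmin]] := closed_min cU Ut dt.
have ab : g a = g b.
  apply: gapU => //; first by lra.
  move=> u Uu; have [usd|sdu] := leP u (s + d); first by left; exact: amax.
  have [tdu|utd] := leP (t - d) u; first by right; exact: bmin.
  by exfalso; apply: Uu; apply: KU; rewrite /= in_itv/= !ltW.
rewrite (le_trans (metric_triangle _ (g a) _))// [leRHS](splitr e) lerD//.
  by rewrite ltW// gs// ler0_norm; lra.
by rewrite ab metric_sym ltW// gt// ger0_norm; lra.
Qed.

Definition clamp01 (R : realType) (t : R) : R := Num.min 1 (Num.max 0 t).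

Lemma clamp01_id (R : realType) (t : R) : 0 <= t -> t <= 1 -> clamp01 t = t.
Proof. by move=> t0 t1; rewrite /clamp01 (max_idPr t0) (min_idPr t1). Qed.

Lemma clamp01_itv (R : realType) (t : R) : 0 <= clamp01 t <= 1.
Proof. by rewrite le_min ler01/= le_max lexx/= ge_min lexx. Qed.

Lemma clamp01_lip (R : realType) (s t : R) :
  `|clamp01 s - clamp01 t| <= `|s - t|.
Proof.
have h1 := ler_norm (s - t); have h2 := ler_norm (t - s).
rewrite distrC in h2; move: `|s - t| h1 h2 => z h1 h2.
rewrite ler_norml /clamp01; case: (leP 0 s); case: (leP 0 t) => ? ?;
  rewrite ?(min_idPr ler01); case: (leP 1 s) => ?; case: (leP 1 t) => ?; lra.
Qed.

Lemma clamp01_continuous (R : realType) : continuous (@clamp01 R).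
Proof.
move=> t; apply/cvgrPdist_lt => e e0.
apply/nbhs_ballP; exists e => //= u.
exact: le_lt_trans (clamp01_lip _ _).
Qed.

(** Otherwise cutting []s, t[] out of [A] would give a smaller loop-erasing set: each of its gaps is
    a gap of [A] or the new gap from [s] to [t]. *)
Lemma loop_erasing_minP (R : realType) (T : Type) (g : R -> T) (A : set R) :
  loop_erasing g A ->
  (forall B, loop_erasing g B -> B `<=` A -> B = A) ->
  forall s t u, A s -> A t -> A u -> 0 <= s -> s < t -> t <= 1 -> g s = g t ->
  u <= s \/ t <= u.
Proof.
move=> [cA A0 A1 gapA] Amin s t u As At Au s0 st t1 gst.
suff AE : [set v | A v /\ ~ (s < v < t)] = A.
  have [_ nu] : [set v | A v /\ ~ (s < v < t)] u by rewrite AE.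
  have [us|su] := leP u s; first by left.
  by have [tu|ut] := leP t u; [right|rewrite su ut in nu].
apply: Amin; last by move=> v [].
split => [||| a b [Aa na] [Ab nb] ab gap].
- have -> : [set v | A v /\ ~ (s < v < t)] = A `&` ~` `]s, t[.
    by apply/seteqP; split => v /=; rewrite in_itv.
  by apply: closedI => //; apply: open_closedC; exact: itv_open.
- by split => //; rewrite ltNge s0.
- by split => //; rewrite [_ < t]ltNge t1 andbF.
- have [[v [Av /andP[av vb]]]|nav] := pselect (exists v, A v /\ a < v < b).
    have sv : s < v < t.
      apply: contrapT => nsv; have [] := gap v (conj Av nsv); lra.
    have sa : a = s.
      apply/eqP; rewrite eq_le; apply/andP; split; rewrite leNgt; apply/negP => H.
        by apply: na; rewrite H/=; case/andP: sv => _; exact: lt_trans.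
      have [] : s <= a \/ b <= s by apply: gap; split => //; rewrite ltxx.
        by rewrite leNgt H.
      by case/andP: sv; lra.
    have tb : b = t.
      apply/eqP; rewrite eq_le; apply/andP; split; rewrite leNgt; apply/negP => H.
        have [] : t <= a \/ b <= t by apply: gap; split => //; rewrite ltxx andbF.
          by case/andP: sv; lra.
        by rewrite leNgt H.
      by apply: nb; rewrite H andbT; case/andP: sv; lra.
    by rewrite sa tb.
  apply: gapA => // v Av; have [va|av] := leP v a; first by left.
  have [bv|vb] := leP b v; first by right.
  by exfalso; apply: nav; exists v; rewrite av.
Qed.

(** The new path waits during the gaps of a minimal [A]: at time [t] it shows [g] at [sg t], the
    last point of [A] up to [t]. Minimality forbids returning to a point after leaving it. *)
Lemma monotone_path (R : realType) (X : metricType R) (g : R -> X) :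
  continuous g ->
  exists h : R -> X, [/\ continuous h, h 0 = g 0, h 1 = g 1,
    forall t, exists s, h t = g s &
    forall s u t, 0 <= s -> s <= u -> u <= t -> t <= 1 -> h s = h t ->
      h u = h s].
Proof.
move=> cg; have [A gA Amin] := loop_erasing_min cg.
have AminP := loop_erasing_minP gA Amin.
have [cA A0 A1 gapA] := gA.
have /choice[sg sgP] t : exists m, 0 <= t ->
    [/\ A m, 0 <= m <= t & forall w, A w -> w <= t -> w <= m].
  have [t0|_] := leP 0 t; last by exists 0.
  by have [m] := closed_max cA A0 t0; exists m.
have sg_mono s t : 0 <= s -> s <= t -> sg s <= sg t.
  move=> s0 st; have [As /andP[_ ss] _] := sgP _ s0.
  by have [_ _] := sgP _ (le_trans s0 st); apply => //; exact: le_trans st.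
(* Although [sg] jumps, the values of [g] at [sg s] and [sg t] are equal or also taken at times in
   [[s, t]], because the two ends of a gap have the same value. Continuity of [g] thus carries
   over. *)
have hP s t : 0 <= s -> s <= t -> t <= 1 -> g (sg s) = g (sg t) \/
    exists b c, [/\ s <= b <= t, s <= c <= t, g (sg s) = g b & g (sg t) = g c].
  move=> s0 st t1.
  have [As /andP[_ ss] smax] := sgP _ s0.
  have [At /andP[_ tt] tmax] := sgP _ (le_trans s0 st).
  have [b [Ab /andP[sb b1] bmin]] := closed_min cA A1 (le_trans st t1).
  have [bt|tb] := leP b t.
    right; exists b, (sg t).
    have bsgt : b <= sg t by exact: tmax.
    rewrite sb bt (le_trans sb bsgt) tt; split => //.
    have [->//|sgsb] := eqVneq (sg s) b.
    apply: gapA => //; first by rewrite lt_neqAle sgsb (le_trans ss).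
    move=> u Au; have [us|/ltW su] := leP u s; first by left; exact: smax.
    by right; exact: bmin.
  left; congr g; apply/eqP; rewrite eq_le sg_mono//= smax//.
  rewrite leNgt; apply/negP => sst.
  by have := bmin _ At (ltW sst); rewrite leNgt (le_lt_trans tt).
exists (fun t => g (sg (clamp01 t))); split.
- move=> t; apply/metricType_numDomainType.cvgrPdist_lt => e e0.
  have e20 : 0 < e / 2 by rewrite divr_gt0.
  have /metricType_numDomainType.cvgrPdist_lt/(_ _ e20) := cg (clamp01 t).
  move=> /nbhs_ballP[d /= d0 td].
  apply/nbhs_ballP; exists d => //= u tu.
  have {}tu : `|clamp01 t - clamp01 u| < d by exact: le_lt_trans (clamp01_lip _ _) tu.
  have near b c : `|clamp01 t - b| < d -> `|clamp01 t - c| < d -> mdist (g b) (g c) < e.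
    move=> /td /= tb /td /= tc;
    rewrite (le_lt_trans (metric_triangle _ (g (clamp01 t)) _))//.
    by rewrite (splitr e) ltrD// metric_sym.
  move: tu near; move: (clamp01 t) (clamp01 u) (clamp01_itv t) (clamp01_itv u).
  move=> {t td} {}t {}u /andP[t0 t1] /andP[u0 u1] tu near.
  have [ltu|/ltW lut] := leP t u.
    have [->|[b [c [tbu tcu -> ->]]]] := hP _ _ t0 ltu u1; first by rewrite mdistxx.
    by apply: near; move: tu tbu tcu; rewrite !ltr_norml; lra.
  have [->|[b [c [tbu tcu -> ->]]]] := hP _ _ u0 lut t1; first by rewrite mdistxx.
  by apply: near; move: tu tbu tcu; rewrite !ltr_norml; lra.
- rewrite clamp01_id//; congr g; have [_ /andP[l0 g0] _] := sgP 0 (lexx _).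
  by apply/eqP; rewrite eq_le l0 g0.
- rewrite clamp01_id//; congr g; have [_ /andP[_ g0] m1] := sgP 1 ler01.
  by apply/eqP; rewrite eq_le g0 m1.
- by move=> t; exists (sg (clamp01 t)).
- move=> s u t s0 su ut t1.
  have u0 := le_trans s0 su; have t0 := le_trans u0 ut.
  have u1 := le_trans ut t1; have s1 := le_trans su u1.
  rewrite !clamp01_id// => gst.
  have [As /andP[ss0 ss] smax] := sgP _ s0.
  have [At /andP[_ tt] _] := sgP _ t0.
  have [Au _ _] := sgP _ u0.
  have sgsu := sg_mono _ _ s0 su; have sgut := sg_mono _ _ u0 ut.
  have [sgst|sgst] := eqVneq (sg s) (sg t).
    by congr g; apply/eqP; rewrite eq_le sgsu sgst sgut.
  have [||us|tu] := AminP (sg s) (sg t) (sg u) As At Au ss0 _ _ gst.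
  - by rewrite lt_neqAle sgst (le_trans sgsu).
  - exact: le_trans t1.
  - by congr g; apply/eqP; rewrite eq_le us.
  - by rewrite gst; congr g; apply/eqP; rewrite eq_le sgut.
Qed.

(** * Heights along monotone paths *)

Definition runmax (R : realType) (phi : R -> R) (t : R) : R :=
  sup [set phi u | u in `[0, t]].

Lemma le_runmax (R : realType) (phi : R -> R) (B u t : R) :
  (forall v, phi v <= B) -> 0 <= u <= t -> phi u <= runmax phi t.
Proof.
move=> phiB ut; apply: ub_le_sup; first by exists B => _ [v _ <-].
by exists u => //=; rewrite in_itv.
Qed.

Lemma runmax_le (R : realType) (phi : R -> R) (b t : R) :
  0 <= t -> (forall u, 0 <= u <= t -> phi u <= b) -> runmax phi t <= b.
Proof.
move=> t0 phib; apply: ge_sup.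
  by exists (phi 0), 0 => //=; rewrite in_itv/= lexx.
by move=> _ [u /= ut <-]; apply: phib; rewrite in_itv in ut.
Qed.

Definition bump (R : realType) (X : metricType R) (c : X) (r : R) (x : X) : R :=
  Num.max 0 (r - mdist c x).

Lemma bump_lip (R : realType) (X : metricType R) (c : X) (r : R) (x y : X) :
  bump c r y <= bump c r x + mdist x y.
Proof.
rewrite /bump; have := metric_triangle c y x; rewrite (metric_sym y x).
have := mdist_ge0 x y.
case: (leP 0 (r - mdist c x)); case: (leP 0 (r - mdist c y)); lra.
Qed.

Definition dyadic_sum (R : realType) (a : nat -> R) (n : nat) : R :=
  \sum_(k < n) a k / 2 ^+ k.+1.

Lemma dyadic_sumS (R : realType) (a : nat -> R) (n : nat) :
  dyadic_sum a n.+1 = dyadic_sum a n + a n / 2 ^+ n.+1.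
Proof. by rewrite /dyadic_sum big_ord_recr. Qed.

Lemma dyadic_sum_le (R : realType) (a : nat -> R) (e : R) (n : nat) :
  0 <= e -> (forall k, a k <= e) -> dyadic_sum a n <= e.
Proof.
(* The induction needs the sharper bound [e - e / 2 ^+ n]. *)
move=> e0 ae; apply: (@le_trans _ _ (e - e / 2 ^+ n)); last first.
  by rewrite gerBl divr_ge0// exprn_ge0.
elim: n => [|n IH]; first by rewrite /dyadic_sum big_ord0 expr0 divr1 subrr.
rewrite dyadic_sumS; apply: (@le_trans _ _ (e - e / 2 ^+ n + e / 2 ^+ n.+1)).
  by rewrite lerD// ler_pM2r// invr_gt0 exprn_gt0.
have -> : e / 2 ^+ n = e / 2 ^+ n.+1 + e / 2 ^+ n.+1.
  by rewrite exprS invfM; lra.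
by lra.
Qed.

Lemma dyadic_sum_ge (R : realType) (a : nat -> R) (m n : nat) :
  (forall k, 0 <= a k) -> (m < n)%N -> a m / 2 ^+ m.+1 <= dyadic_sum a n.
Proof.
move=> a0 mn; rewrite /dyadic_sum (bigD1 (Ordinal mn))//= lerDl sumr_ge0//.
by move=> i _; rewrite divr_ge0// exprn_ge0.
Qed.

Lemma dyadic_sum_cvg (R : realType) (a : nat -> R) :
  (forall k, 0 <= a k <= 1) -> cvgn (dyadic_sum a).
Proof.
move=> a01; apply: nondecreasing_is_cvgn.
  apply/nondecreasing_seqP => n; rewrite dyadic_sumS lerDl divr_ge0 ?exprn_ge0//.
  by have /andP[] := a01 n.
by exists 1 => _ [n _ <-]; apply: dyadic_sum_le => // k; have /andP[] := a01 k.
Qed.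

Lemma dyadic_sumB (R : realType) (a b : nat -> R) (n : nat) :
  dyadic_sum a n - dyadic_sum b n = dyadic_sum (fun k => a k - b k) n.
Proof. by rewrite /dyadic_sum -sumrB; apply: eq_bigr => k _; rewrite mulrBl. Qed.

(** [F] is a dyadically weighted sum of running maxima of countably many functions along the path.
    Each maximum is nondecreasing and grows at most by the oscillation of [h], which gives
    continuity and constancy wherever [h] rests. *)
Lemma height_exists (R : realType) (X : metricType R) (h : R -> X) :
  continuous h ->
  (forall s u t, 0 <= s -> s <= u -> u <= t -> t <= 1 -> h s = h t ->
     h u = h s) ->
  exists F : R -> R, continuous F /\
    forall s t, 0 <= s -> s <= t -> t <= 1 ->
      F s <= F t /\ (F s = F t <-> h s = h t).
Proof.
move=> ch mh.
(* When the path reaches a new point, a small bump around a nearby [h q] has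
   vanished so far, hence its running maximum increases there. *)
pose phi k u := if unpickle k is Some (q, n) then
  bump (h (ratr q)) (n.+1%:R^-1 : R) (h u) else 0.
have phi0 k u : 0 <= phi k u.
  by rewrite /phi; case: (unpickle k) => // -[q n]; rewrite le_max lexx.
have phi1 k u : phi k u <= 1.
  rewrite /phi; case: (unpickle k) => // -[q n].
  rewrite ge_max ler01/= lerBlDr (@le_trans _ _ 1)//.
    by rewrite invf_le1 ?ler1n ?ltr0n.
  by rewrite lerDl mdist_ge0.
have phi_lip k u v : phi k v <= phi k u + mdist (h u) (h v).
  rewrite /phi; case: (unpickle k) => [[q n]|]; first exact: bump_lip.
  by rewrite add0r mdist_ge0.
pose psi k t := runmax (phi k) t.
have psi01 k t : 0 <= t -> 0 <= psi k t <= 1.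
  move=> t0; apply/andP; split; last exact: runmax_le.
  by apply: le_trans (phi0 k 0) _; apply: le_runmax (phi1 k) _; rewrite lexx.
have psi_mono k s t : 0 <= s -> s <= t -> psi k s <= psi k t.
  move=> s0 st; apply: runmax_le => // u /andP[u0 us].
  by apply: le_runmax (phi1 k) _; rewrite u0 (le_trans us).
have psi_osc k s t e : 0 <= s -> s <= t -> 0 <= e ->
    (forall u, s <= u <= t -> mdist (h s) (h u) <= e) ->
    psi k t <= psi k s + e.
  move=> s0 st e0 osc; apply: runmax_le => [|u /andP[u0 ut]].
    exact: le_trans st.
  have [us|/ltW su] := leP u s.
    by rewrite ler_wpDr//; apply: le_runmax (phi1 k) _; rewrite u0.
  apply: le_trans (phi_lip k s u) _; rewrite lerD ?osc ?su//.
  by apply: le_runmax (phi1 k) _; rewrite s0 lexx.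
pose S t := dyadic_sum (psi^~ t).
have cS t : 0 <= t -> cvgn (S t) by move=> t0; apply: dyadic_sum_cvg => k; exact: psi01.
pose F t := limn (S t).
have cB s t : 0 <= s -> 0 <= t -> (fun n => S t n - S s n) @ \oo --> F t - F s.
  by move=> s0 t0; apply: cvgB; exact: cS.
have F_mono s t : 0 <= s -> s <= t -> F s <= F t.
  move=> s0 st; rewrite -subr_ge0.
  apply: cvgr_to_ge (cB _ _ s0 (le_trans s0 st)) _; apply: nearW => n.
  rewrite dyadic_sumB sumr_ge0// => k _.
  by rewrite divr_ge0 ?exprn_ge0// subr_ge0 psi_mono.
have F_osc s t e : 0 <= s -> s <= t -> 0 <= e ->
    (forall u, s <= u <= t -> mdist (h s) (h u) <= e) -> F t - F s <= e.
  move=> s0 st e0 osc.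
  apply: cvgr_to_le (cB _ _ s0 (le_trans s0 st)) _; apply: nearW => n.
  by rewrite dyadic_sumB dyadic_sum_le// => k; rewrite lerBlDl psi_osc.
exists (F \o @clamp01 R); split.
  move=> t; apply/cvgrPdist_lt => e e0.
  have e20 : 0 < e / 2 by rewrite divr_gt0.
  have e40 : 0 < e / 4 by rewrite divr_gt0.
  have /metricType_numDomainType.cvgrPdist_lt/(_ _ e40) := ch (clamp01 t).
  move=> /nbhs_ballP[d /= d0 td].
  apply/nbhs_ballP; exists d => //= u tu.
  have {}tu : `|clamp01 t - clamp01 u| < d by exact: le_lt_trans (clamp01_lip _ _) tu.
  have near b c : `|clamp01 t - b| < d -> `|clamp01 t - c| < d ->
      mdist (h b) (h c) <= e / 2.
    move=> /td /= tb /td /= tc;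
    rewrite (le_trans (metric_triangle _ (h (clamp01 t)) _))//.
    by move: tb tc; rewrite (metric_sym (h b)); lra.
  move: tu near; move: (clamp01 t) (clamp01 u) (clamp01_itv t) (clamp01_itv u).
  move=> {t td} {}t {}u /andP[t0 t1] /andP[u0 u1] tu near.
  have [ltu|/ltW lut] := leP t u.
    rewrite distrC ger0_norm ?subr_ge0 ?F_mono//.
    apply: (@le_lt_trans _ _ (e / 2)); last by lra.
    apply: F_osc => //; first exact: ltW.
    by move=> v vtu; apply: near; move: tu; rewrite !ltr_norml; lra.
  rewrite ger0_norm ?subr_ge0 ?F_mono//.
  apply: (@le_lt_trans _ _ (e / 2)); last by lra.
  apply: F_osc => //; first exact: ltW.
  by move=> v vtu; apply: near; move: tu; rewrite !ltr_norml; lra.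
move=> s t s0 st t1 /=.
have t0 := le_trans s0 st; have s1 := le_trans st t1.
rewrite !clamp01_id//; split; first exact: F_mono.
split=> [FE|hst]; last first.
  apply/eqP; rewrite eq_le F_mono// -subr_le0; apply: F_osc => // u /andP[su ut].
  by rewrite (mh s u t)// mdistxx.
apply: contrapT => hst.
(* The point [h t] is new after time [s]: an earlier visit at [u <= s] would make [h] constant on
   [[u, t]] and force [h s = h t]. *)
have clK : closed (h @` `[0, s]).
  apply: compact_closed; first exact: metric_hausdorff.
  by apply: continuous_compact; [exact: continuous_subspaceT|exact: segment_compact].
have nK : (~` (h @` `[0, s])) (h t).
  move=> [u /=]; rewrite in_itv/= => /andP[u0 us] hut; apply: hst.
  by rewrite (mh u s t)// hut.
have [r r0 rK] := nbhs_mdist (open_nbhs_nbhs (conj (closed_openC clK) nK)).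
have r20 : 0 < r / 2 by rewrite divr_gt0.
have [n _ /(_ n (leqnn n)) /= nr] := near_infty_natSinv_lt (PosNum r20).
have {}nr : n.+1%:R^-1 < r / 2 := nr.
have n0 : 0 < n.+1%:R^-1 :> R by rewrite invr_gt0 ltr0n.
have /metricType_numDomainType.cvgrPdist_lt/(_ _ n0) := ch t.
move=> /nbhs_ballP[d /= d0 td].
have [|q] := @rat_in_itvoo R (t - d) (t + d); first by lra.
rewrite in_itv/= => qt.
have {}/td /= tq : ball t d (ratr q) by rewrite /ball/= ltr_norml; lra.
(* The radius of this bump is below [r / 2] and exceeds the distance from its centre to [h t]. Hence
   it is positive at [h t] and zero on the points visited up to [s], which are at least [r] away
   from [h t]. *)
pose k := pickle (q, n).
have phiE u : phi k u = bump (h (ratr q)) (n.+1%:R^-1 : R) (h u).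
  by rewrite /phi pickleK.
have psis : psi k s <= 0.
  apply: runmax_le => // u us; rewrite phiE ge_max lexx/= subr_le0.
  have ru : r <= mdist (h t) (h u).
    rewrite leNgt; apply/negP => /rK; apply; exists u => //=.
  have := metric_triangle (h t) (h (ratr q)) (h u).
  by move: tq ru nr; move: (n.+1%:R^-1) => rho; lra.
have psit : 0 < psi k t.
  apply: (@lt_le_trans _ _ (phi k t)); last first.
    by apply: le_runmax (phi1 k) _; rewrite t0 lexx.
  by rewrite phiE lt_max subr_gt0 metric_sym tq orbT.
have : (psi k t - psi k s) / 2 ^+ k.+1 <= F t - F s.
  apply: cvgr_to_ge (cB _ _ s0 t0) _.
  exists k.+1 => // m /= km; rewrite dyadic_sumB.
  apply: (@dyadic_sum_ge _ (fun k => psi k t - psi k s)) => // j.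
  by rewrite subr_ge0 psi_mono.
rewrite FE subrr leNgt divr_gt0 ?exprn_gt0//.
by rewrite subr_gt0 (le_lt_trans psis).
Qed.

Lemma open_mdist (R : realType) (X : metricType R) (x : X) (e : R) :
  open [set y | mdist x y < e].
Proof.
rewrite openE => y /= xy; rewrite /interior.
have d0 : 0 < e - mdist x y by rewrite subr_gt0.
apply: filterS (mdist_nbhs y d0) => z /= yz.
by have := metric_triangle x y z; lra.
Qed.

Definition is_arc (R : realType) (X : metricType R) (V : set X) (p q : X)
    (g : R -> X) : Prop :=
  [/\ continuous g, {in `[0, 1] &, injective g}, g 0 = p, g 1 = q &
    forall t, V (g t)].

(** A monotone path is followed by height instead of time. [tau u] is any time of height [lvl u]:
    times of equal height show the same point, and different heights show different points. *)
Lemma arc_exists (R : realType) (X : metricType R) (V : set X) (p q : X) :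
  compact [set: X] -> locally_connected X -> open V -> connected V ->
  V p -> V q -> p <> q -> exists g : R -> X, is_arc V p q g.
Proof.
move=> cptX lcX oV cV Vp Vq pq.
have [g0 [cg0 g00 g01 g0V]] := path_exists cptX lcX oV cV Vp Vq.
have [h [ch h0 h1 hg mh]] := monotone_path cg0.
have [F [cF FP]] := height_exists ch mh.
have F01 : F 0 < F 1.
  have [leF eqF] := FP 0 1 (lexx _) ler01 (lexx _).
  rewrite lt_neqAle leF andbT; apply/eqP => /eqF.
  by rewrite h0 h1 g00 g01.
have FE s t : 0 <= s <= 1 -> 0 <= t <= 1 -> F s = F t <-> h s = h t.
  move=> /andP[s0 s1] /andP[t0 t1].
  have [st|/ltW ts] := leP s t; first by have [_] := FP s t s0 st t1.
  by have [_ FE] := FP t s t0 ts s1; split => /esym/FE.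
pose lvl (u : R) := F 0 + (F 1 - F 0) * clamp01 u.
have clvl : continuous lvl.
  move=> u; apply: cvgD; first exact: cvg_cst.
  by apply: cvgMr; exact: clamp01_continuous.
have /choice[tau tauP] u : exists t, 0 <= t <= 1 /\ F t = lvl u.
  have [||t] := @IVT R F 0 1 (lvl u) ler01.
  - exact: continuous_subspaceT.
  - rewrite (min_idPl (ltW F01)) (max_idPr (ltW F01)).
    have := clamp01_itv u; rewrite /lvl; move: F01; nra.
  by rewrite in_itv/= => t01 Ft; exists t.
have hE u t : 0 <= t <= 1 -> F t = lvl u -> h t = h (tau u).
  by move=> t01 Ft; have [tau01 Ftau] := tauP u; apply/FE => //; rewrite Ftau.
exists (h \o tau); split => /=.
- move=> u; apply/metricType_numDomainType.cvgrPdist_lt => e e0 /=.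
  (* [tau] itself may jump. The heights of the times at which [h] is far from [h (tau u)] form a
     compact set that misses [lvl u], hence also [lvl v] for [v] near [u]. *)
  pose K := [set t | e <= mdist (h (tau u)) (h t)] `&` `[0, 1].
  have cK : compact K.
    rewrite /K setIC; apply: compact_closedI; first exact: segment_compact.
    have -> : [set t | e <= mdist (h (tau u)) (h t)] =
        ~` (h @^-1` [set y | mdist (h (tau u)) y < e]).
      by apply/seteqP; split => t /=; rewrite leNgt => /negP.
    apply: open_closedC; move/continuousP : ch; apply.
    exact: open_mdist.
  have clFK : closed (F @` K).
    apply: compact_closed; first exact: Rhausdorff.
    by apply: continuous_compact => //; exact: continuous_subspaceT.
  have nFK : (~` (F @` K)) (lvl u).
    move=> [t [/= et]]; rewrite in_itv/= => t01 /(hE _ _ t01) ht.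
    by move: et; rewrite ht mdistxx leNgt e0.
  have : \forall v \near u, (~` (F @` K)) (lvl v).
    by apply: (clvl u); apply: open_nbhs_nbhs; split => //; exact: closed_openC.
  apply: filterS => v nv.
  rewrite ltNge; apply/negP => ev; apply: nv.
  have [tau01 Ftau] := tauP v; exists (tau v) => //; split => //=.
- move=> u v; rewrite !in_itv/= => u01 v01 huv.
  have [tu Fu] := tauP u; have [tv Fv] := tauP v.
  have := (FE _ _ tu tv).2 huv; rewrite Fu Fv /lvl.
  case/andP: u01 => u0 u1; case/andP: v01 => v0 v1; rewrite !clamp01_id//.
  have nz : F 1 - F 0 != 0 by rewrite subr_eq0 gt_eqF.
  by move=> /addrI /(mulfI nz).
- rewrite -(hE 0 0) ?lexx ?ler01 ?h0//.
  by rewrite /lvl clamp01_id// mulr0 addr0.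
- rewrite -(hE 1 1) ?lexx ?ler01 ?h1//.
  by rewrite /lvl clamp01_id// mulr1 addrC subrK.
- by move=> u; have [s ->] := hg (tau u).
Qed.

Lemma compact_inverse_continuous (S T : topologicalType) (K : set S)
    (g : S -> T) (h : T -> S) :
  hausdorff_space T -> compact K -> {within K, continuous g} ->
  {in K, cancel g h} -> {within g @` K, continuous h}.
Proof.
move=> hT cK cg gK; apply/continuous_closedP => F cF.
apply/closed_subspaceP; exists (g @` (K `&` F)).
  apply: compact_closed => //; apply: continuous_compact.
    by apply: continuous_subspaceW cg; exact: subIsetl.
  exact: compact_closedI.
apply/seteqP; split => [y [[x [Kx Fx] gxy] [z Kz gzy]]|y [Fy [x Kx gxy]]].
  have hy : h y = x by rewrite -gxy gK ?inE.
  by split; [change (F (h y)); rewrite hy|exists z].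
have hy : h y = x by rewrite -gxy gK ?inE.
split; last by exists x.
by exists x => //; split => //; rewrite -hy; exact: Fy.
Qed.

Lemma unit_circle_closed (R : realType) : closed (unit_circle R).
Proof.
have -> : unit_circle R =
    (fun p : R * R => p.1 * p.1 + p.2 * p.2) @^-1` [set 1].
  by apply/seteqP; split => p; rewrite /unit_circle /= !expr2.
apply: closed_comp => [p _|]; last exact: closed_eq.
apply: cvgD; apply: cvgM; (exact: cvg_fst || exact: cvg_snd).
Qed.

Lemma unit_circle_itv (R : realType) (p : R * R) : unit_circle R p ->
  (-1 <= p.1 <= 1) && (-1 <= p.2 <= 1).
Proof. by rewrite /unit_circle /= => H; nra. Qed.

Lemma unit_circle_compact (R : realType) : compact (unit_circle R).
Proof.
apply: (@subclosed_compact _ _ (`[(-1 : R), 1]%classic `*` `[(-1 : R), 1]%classic)).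
- exact: unit_circle_closed.
- by apply: compact_setX; exact: segment_compact.
- by move=> p /unit_circle_itv /andP[p1 p2]; split => /=; rewrite in_itv.
Qed.

(** * Simple closed curves *)

(* The circle is parametrised by its first coordinate, upper half by [a] and
   lower half by [b]. *)
Lemma two_arcs_circle (R : realType) (X : metricType R) (a b : R -> X) :
  continuous a -> continuous b ->
  {in `[-1, 1] &, injective a} -> {in `[-1, 1] &, injective b} ->
  a (-1) = b (-1) -> a 1 = b 1 ->
  (forall s t, s \in `[-1, 1] -> t \in `[-1, 1] -> a s = b t ->
    s = -1 \/ s = 1) ->
  exists C : set X, simple_closed_curve R C.
Proof.
move=> ca cb ia ib abN1 ab1 abE.
pose g (p : R * R) := if 0 <= p.2 then a p.1 else b p.1.
have cc := @unit_circle_compact R.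
have c1 p : unit_circle R p -> p.1 \in `[-1, 1].
  by move=> /unit_circle_itv/andP[]; rewrite in_itv.
have cE p q : unit_circle R p -> unit_circle R q -> p.1 = q.1 ->
    (0 <= p.2) = (0 <= q.2) -> p = q.
  case: p q => [p1 p2] [q1 q2]; rewrite /unit_circle/= => cp cq pq.
  rewrite -{}pq in cq * => pq; congr pair.
  have : p2 ^+ 2 = q2 ^+ 2 by lra.
  move/eqP; rewrite eqf_sqr => /orP[/eqP//|/eqP pNq].
  by case: (leP 0 p2) pq; case: (leP 0 q2) => //; lra.
have c0 p : unit_circle R p -> p.1 = -1 \/ p.1 = 1 -> p.2 = 0.
  rewrite /unit_circle/= => cp p1; apply/eqP; rewrite -sqrf_eq0; apply/eqP.
  have p11 : p.1 ^+ 2 = 1 by case: p1 => ->; rewrite ?sqrrN expr1n.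
  by move: cp; rewrite p11; lra.
have gi p q : unit_circle R p -> unit_circle R q -> g p = g q -> p = q.
  wlog pq : p q / (0 <= q.2) ==> (0 <= p.2) => [hw cp cq gpq|cp cq].
    have [q0|] := boolP ((0 <= q.2) ==> (0 <= p.2)); first exact: hw.
    by rewrite negb_imply => /andP[q0 p0]; apply/esym/hw => //; rewrite q0 implybT.
  rewrite /g; case: ifPn pq => p0; case: ifPn => q0 // _ gpq.
  - by apply: cE => //; [apply: ia => //; exact: c1|rewrite p0 q0].
  - have p1 := abE _ _ (c1 _ cp) (c1 _ cq) gpq.
    suff q1 : q.1 = -1 \/ q.1 = 1 by rewrite (c0 _ cq q1) lexx in q0.
    have : q.1 = p.1.
      apply: ib; [exact: c1|exact: c1|]; rewrite -gpq.
      by case: p1 => ->.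
    by move->.
  - apply: cE => //; last by rewrite (negbTE p0) (negbTE q0).
    by apply: ib => //; exact: c1.
have cg : {within unit_circle R, continuous g}.
  have -> : unit_circle R = (unit_circle R `&` [set p | 0 <= p.2]) `|`
      (unit_circle R `&` [set p | p.2 <= 0]).
    apply/seteqP; split => [p cp|p [[]|[]]//].
    by have [p0|/ltW p0] := leP 0 p.2; [left|right].
  apply: withinU_continuous.
  - apply: closedI; first exact: unit_circle_closed.
    apply: (@closed_comp _ _ (@snd R R) [set x | 0 <= x]); last exact: closed_ge.
    by move=> p _; exact: cvg_snd.
  - apply: closedI; first exact: unit_circle_closed.
    apply: (@closed_comp _ _ (@snd R R) [set x | x <= 0]); last exact: closed_le.
    by move=> p _; exact: cvg_snd.
  - apply: (@subspace_eq_continuous _ _ _ (a \o fst)).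
      by move=> p /set_mem [_ /= p0]; rewrite /from_subspace /g/= p0.
    apply: continuous_subspaceT => p.
    by apply: continuous_comp; [exact: cvg_fst|exact: ca].
  - apply: (@subspace_eq_continuous _ _ _ (b \o fst)).
      move=> p /set_mem [cp /= p0]; rewrite /from_subspace /g/=; case: ifPn => // p0'.
      have p20 : p.2 = 0 by apply/eqP; rewrite eq_le p0.
      move: cp; rewrite /unit_circle/= p20 expr0n/= addr0 => /eqP.
      by rewrite sqrf_eq1 => /orP[]/eqP ->.
    apply: continuous_subspaceT => p.
    by apply: continuous_comp; [exact: cvg_fst|exact: cb].
have /choice[h hP] x : exists p, (g @` unit_circle R) x ->
    unit_circle R p /\ g p = x.
  have [[p cp gp]|nx] := pselect ((g @` unit_circle R) x); first by exists p.
  by exists (0, 0).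
have gK : {in unit_circle R, cancel g h}.
  move=> p /set_mem cp.
  have [|ch gh] := hP (g p); first by exists p.
  exact: gi.
exists (g @` unit_circle R), g, h; split => //.
by apply: compact_inverse_continuous => //; exact: metric_hausdorff.
Qed.

(** [a r] lies off [b], which stays in [W]. The last time [l] before [r] and the first time [m]
    after [r] at which [a] is on [b] bound a subarc of [a] meeting [b] only at its ends; it closes
    up with the part of [b] between these ends. *)
Lemma arcs_circle (R : realType) (X : metricType R) (V W : set X) (p q : X)
    (a b : R -> X) (r : R) :
  is_arc V p q a -> is_arc W p q b -> 0 < r < 1 -> ~ W (a r) ->
  exists C : set X, simple_closed_curve R C.
Proof.
move=> [ca ia a0 a1 _] [cb ib b0 b1 bW] /andP[r0 r1] nWr.
pose B := b @` `[0, 1].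
have clB : closed B.
  apply: compact_closed; first exact: metric_hausdorff.
  by apply: continuous_compact; [exact: continuous_subspaceT|exact: segment_compact].
have claB : closed (a @^-1` B) by apply: closed_comp.
have aB0 : (a @^-1` B) 0 by exists 0; [rewrite /= in_itv/= lexx ler01|rewrite a0 b0].
have aB1 : (a @^-1` B) 1 by exists 1; [rewrite /= in_itv/= lexx ler01|rewrite a1 b1].
have [l [[u /= u01 bu] /andP[l0 lr] lmax]] := closed_max claB aB0 (ltW r0).
have [m [[v /= v01 bv] /andP[rm m1] mmin]] := closed_min claB aB1 (ltW r1).
rewrite in_itv/= in u01; rewrite in_itv/= in v01.
have nr t : b t <> a r by move=> btr; apply: nWr; rewrite -btr.
have {}lr : l < r.
  by rewrite lt_neqAle lr andbT; apply/eqP => lE; apply: (nr u); rewrite bu lE.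
have {}rm : r < m.
  by rewrite lt_neqAle rm andbT; apply/eqP => rE; apply: (nr v); rewrite bv rE.
have lm : l < m by exact: lt_trans rm.
have uv : u != v.
  apply/eqP => uv; have : l = m by apply: ia; rewrite ?in_itv/= -?bu -?bv ?uv//; lra.
  by move=> lmE; rewrite lmE ltxx in lm.
(* Affine from [[-1, 1]] onto the segment between [c] and [d]; it may reverse direction, as [u] and
   [v] come in either order. *)
pose line (c d t : R) := c + (d - c) * ((t + 1) / 2).
have line_inj c d : c != d -> injective (line c d).
  move=> cd s t /addrI /mulfI; rewrite subr_eq0 eq_sym => /(_ cd).
  by lra.
have line_itv (c d t : R) : 0 <= c <= 1 -> 0 <= d <= 1 -> t \in `[-1, 1] ->
    line c d t \in `[0, 1].
  by rewrite !in_itv/= /line; nra.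
have cline c d : continuous (line c d).
  move=> t; apply: cvgD; first exact: cvg_cst.
  apply: cvgMr; apply: cvgMl; apply: cvgD; first exact: cvg_id.
  exact: cvg_cst.
have lineN1 c d : line c d (-1) = c by rewrite /line addNr mul0r mulr0 addr0.
have line1 c d : line c d 1 = d.
  by rewrite /line (_ : (1 + 1) / 2 = 1) ?mulr1 1?addrC ?subrK//; lra.
have l01 : 0 <= l <= 1 by lra.
have m01 : 0 <= m <= 1 by lra.
apply: (@two_arcs_circle _ _ (a \o line l m) (b \o line u v)) => /=.
- by move=> t; apply: continuous_comp; [exact: cline|exact: ca].
- by move=> t; apply: continuous_comp; [exact: cline|exact: cb].
- move=> s t s1 t1 /= /ia H; apply: (@line_inj l m); first by rewrite lt_eqF.
  by apply: H; exact: line_itv.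
- move=> s t s1 t1 /= /ib H; apply: (@line_inj u v) => //.
  by apply: H; exact: line_itv.
- by rewrite !lineN1.
- by rewrite !line1.
move=> s t s1 t1 abst.
have Bs : (a @^-1` B) (line l m s).
  by exists (line u v t); [exact: line_itv|rewrite -abst].
have : line l m s = l \/ line l m s = m.
  move: s1; rewrite in_itv/= => /andP[Ns s1].
  have [sr|/ltW rs] := leP (line l m s) r.
    by left; have := lmax _ Bs sr; rewrite /line; nra.
  by right; have := mmin _ Bs rs; rewrite /line; nra.
by case=> [E|E]; [left|right]; apply: (@line_inj l m);
  rewrite ?lineN1 ?line1// lt_eqF.
Qed.

(** * Halfspaces of a dendrite *)

Lemma component_open (T : topologicalType) (V : set T) (x : T) :
  locally_connected T -> open V -> open (connected_component V x).
Proof.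
move=> lcT oV; rewrite openE => y xy; rewrite /interior.
have Vy := connected_component_sub xy.
have [W [oW cW Wy WV]] := lcT _ _ (open_nbhs_nbhs (conj oV Vy)).
apply: filterS (open_nbhs_nbhs (conj oW Wy)) => z Wz.
by rewrite (same_connected_component xy); exists W.
Qed.

Lemma connected_between (T : topologicalType) (A B : set T) :
  connected A -> A `<=` B -> B `<=` closure A -> connected B.
Proof.
move=> cA AB BA; apply/connectedP => E [E0 BE sE].
have AE b : ~ A `<=` E b.
  move=> AEb; have [x Ex] := E0 (~~ b).
  have : closure (E b) x.
    by apply: (closureS AEb); apply: BA; rewrite BE; case: b AEb Ex; [left|right].
  move: sE => [s1 s2]; case: b AEb Ex => _ Ex cx.
    by rewrite -[False]/(set0 x) -s2.
  by rewrite -[False]/(set0 x) -s1.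
have [] := connected_subset sE _ cA; [by rewrite -BE|exact: AE|exact: AE].
Qed.

Lemma connected_meets_boundary (T : topologicalType) (S C : set T) :
  connected S -> open C -> S `&` C !=set0 -> S `&` ~` C !=set0 ->
  exists q, [/\ S q, ~ C q & closure C q].
Proof.
move=> cS oC SC [z [Sz nCz]]; apply: contrapT => nq.
have SCE : S `&` C = S.
  apply: cS => //; first by exists C.
  exists (closure C); first exact: closed_closure.
  apply/seteqP; split => x [Sx Cx]; split => //; first exact: subset_closure.
  by apply: contrapT => nCx; apply: nq; exists x.
by apply: nCz; have [] : (S `&` C) z by rewrite SCE.
Qed.

Definition halfspace (T : topologicalType) (C : set T) : Prop :=
  [/\ open C, connected C & connected (~` C)].

Section punctured_component.
Variables (R : realType) (X : metricType R) (r : X).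
Hypotheses (cX : connected [set: X]) (lcX : locally_connected X).

Let K := connected_component (~` [set r]).

Let oV : open (~` [set r]).
Proof.
apply: closed_openC; apply: accessible_closed_set1.
exact/hausdorff_accessible/metric_hausdorff.
Qed.

Let K_open x : open (K x). Proof. exact: component_open. Qed.

Let nKr x : ~ K x r. Proof. by move=> /connected_component_sub; apply. Qed.

Lemma component_setU1_closed x : open (~` (K x `|` [set r])).
Proof.
rewrite openE => w nw; rewrite /interior.
have wr : (~` [set r]) w by move=> wr; apply: nw; right.
have Kw : K w w by exact: connected_component_refl.
apply: filterS (open_nbhs_nbhs (conj (K_open w) Kw)) => z wz [xz|zr].
  apply: nw; left; apply: connected_component_trans xz _.
  exact: connected_component_sym.
by apply: (@nKr w); rewrite -zr.
Qed.

(** If [r] were not adherent to [K x], this component would be open and closed in the connected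
    space, hence everything, including [r]. *)
Lemma closure_component x : x <> r -> closure (K x) = K x `|` [set r].
Proof.
move=> xr; have Kx : K x x by exact: connected_component_refl.
have clKU : closure (K x) `<=` K x `|` [set r].
  have : closed (K x `|` [set r]).
    by rewrite -(setCK (_ `|` _)); apply: open_closedC; exact: component_setU1_closed.
  by move=> /closure_id ->; apply: closureS => z; left.
apply/seteqP; split => // z [/subset_closure//|->].
apply: contrapT => nr; apply: (@nKr x).
suff -> : K x = [set: X] by [].
apply: cX; first by exists x.
  by exists (K x) => //; rewrite setTI.
exists (closure (K x)); first exact: closed_closure.
rewrite setTI; apply/seteqP; split; first exact: subset_closure.
by move=> w cw; have [//|wr] := clKU _ cw; rewrite wr in cw.
Qed.

(** The complement of [K x] is the union of the closures of the other components, all of which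
    contain [r]; the component of [y] is one of them. *)
Lemma component_halfspace x y : y <> r -> ~ K x y -> halfspace (K x).
Proof.
move=> yr nxy; split; [exact: K_open|exact: component_connected|].
have -> : ~` (K x) = \bigcup_(z in [set z | z <> r /\ ~ K x z]) closure (K z).
  apply/seteqP; split => [z nxz|w [z [zr nxz]]].
    have [->|zr] := pselect (z = r).
      by exists y => //; rewrite closure_component//; right.
    exists z => //; apply: subset_closure; exact: connected_component_refl.
  rewrite closure_component// => -[zw xw|->]; last exact: nKr.
  apply: nxz; apply: connected_component_trans xw _.
  exact: connected_component_sym.
apply: bigcup_connected.
  by exists r => z [zr _]; rewrite closure_component//; right.
by move=> z _; apply: connected_closure; exact: component_connected.
Qed.

End punctured_component.

(** [r] is the midpoint of an arc from [x] to [y], and [C] the component of [x] off [r]. Were [y] in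
    [C], an arc inside [C] would join [x] to [y] avoiding [r], and the two arcs would contain a
    simple closed curve. *)
Lemma dendrite_separation (R : realType) (X : metricType R) (x y : X) :
  dendrite X -> x <> y ->
  exists (C : set X) (r : X), [/\ halfspace C, C x, ~ C r,
    open (~` (C `|` [set r])) & (~` (C `|` [set r])) y].
Proof.
have half : (0 : R) < (2^-1 : R) < 1 by lra.
have h01 : (0 : R) <= (2^-1 : R) <= 1 by lra.
have half0 : 0 <> 2^-1 :> R by apply/eqP; rewrite lt_eqF//; lra.
have half1 : 1 <> 2^-1 :> R by apply/eqP; rewrite gt_eqF//; lra.
move=> [[_ cptX cX] lcX nocirc] xy.
have [a aP] := arc_exists cptX lcX openT cX (I : [set: X] x) (I : [set: X] y) xy.
have [ca ia a0 a1 _] := aP.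
pose r := a 2^-1.
have xr : x <> r.
  by rewrite -a0 => /ia H; apply/half0/H; rewrite in_itv//= lexx ler01.
have yr : y <> r.
  by rewrite -a1 => /ia H; apply/half1/H; rewrite in_itv//= lexx ler01.
pose C := connected_component (~` [set r]) x.
have Cx : C x by exact: connected_component_refl.
have nCr : ~ C r by move=> /connected_component_sub; apply.
have oV : open (~` [set r]).
  apply: closed_openC; apply: accessible_closed_set1.
  exact/hausdorff_accessible/metric_hausdorff.
have nCy : ~ C y.
  move=> Cy; have oC : open C by exact: component_open.
  have cC : connected C by exact: component_connected.
  have [b bP] := arc_exists cptX lcX oC cC Cx Cy xy.
  by have [D] := arcs_circle aP bP half nCr; exact: nocirc.
exists C, r; split => //.
- exact: component_halfspace nCy.
- exact: component_setU1_closed.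
- by move=> [].
Qed.

Section halfspaces.
Variables (R : realType) (X : metricType R).
Hypothesis dX : dendrite X.

(* Two boundary points would be separated by a third point, which the connected
   sets [~` A] and [A] together with both points would share. *)
Lemma halfspace_boundary_unique (A : set X) (p q : X) : halfspace A ->
  ~ A p -> closure A p -> ~ A q -> closure A q -> p = q.
Proof.
move=> [oA cA cnA] nAp clAp nAq clAq; apply: contrapT => pq.
have [C [r [[oC _ _] Cp nCr oD Dq]]] := dendrite_separation dX pq.
have sepCD : separated C (~` (C `|` [set r])).
  split; apply/seteqP; split => // z.
    move=> [clz Dz].
    by have [w [Cw]] := clz _ (open_nbhs_nbhs (conj oD Dz)); apply; left.
  move=> [Cz clz].
  have [w [nw Cw]] := clz _ (open_nbhs_nbhs (conj oC Cz)).
  by apply: nw; left.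
have Sr S : connected S -> S p -> S q -> S r.
  move=> cS Sp Sq; apply: contrapT => nSr.
  have SCD : S `<=` C `|` ~` (C `|` [set r]).
    move=> z Sz; have [Cz|nCz] := pselect (C z); first by left.
    by right=> -[//|zr]; rewrite zr in Sz.
  have [SC|SD] := connected_subset sepCD SCD cS.
    exact: (Dq (or_introl (SC _ Sq))).
  exact: (SD _ Sp (or_introl Cp)).
have nAr : (~` A) r by exact: Sr.
have : (A `|` [set p; q]) r.
  apply: (Sr (A `|` [set p; q])); [|by right; left|by right; right].
  apply: connected_between cA _ _ => z; first by left.
  by case=> [/subset_closure//|[->|->]].
case=> [//|[rp|rq]]; first by rewrite rp in nCr.
exact: (Dq (or_intror (esym rq))).
Qed.

Definition crossing (T : Type) (A C : set T) : Prop :=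
  [/\ A `&` C !=set0, A `&` ~` C !=set0, ~` A `&` C !=set0 &
      ~` A `&` ~` C !=set0].

Lemma halfspace_noncrossing (A C : set X) : halfspace A -> halfspace C ->
  ~ crossing A C.
Proof.
move=> [_ cA cnA] sC [AC AnC nAC nAnC]; have [oC _ _] := sC.
have [p [Ap nCp clp]] := connected_meets_boundary cA oC AC AnC.
have [q [nAq nCq clq]] := connected_meets_boundary cnA oC nAC nAnC.
by apply: nAq; rewrite -(halfspace_boundary_unique sC nCp clp nCq clq).
Qed.

(** Off the diagonal one halfspace serves a whole neighbourhood of a pair, and near the diagonal
    distances are below [e]. Compactness of the square, along the filter of growing finite families,
    yields one family for all pairs. *)
Lemma separating_halfspaces (e : R) : 0 < e ->
  exists s : seq (set X), (forall C, C \in s -> halfspace C) /\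
    forall x y, e <= mdist x y -> exists2 C, C \in s & C x /\ ~ C y.
Proof.
move=> e0; have [[_ cptX _] _ _] := dX.
have := compact_setX cptX cptX; rewrite setXTT => /compact_near_coveringP cXX.
pose good (s : seq (set X)) := forall C, C \in s -> halfspace C.
pose G := filter_from good (fun s => [set t | good t /\ {subset s <= t}]).
have GF : Filter G.
  apply: filter_from_filter; first by exists [::].
  move=> s t gs gt; exists (s ++ t).
    by move=> C; rewrite mem_cat => /orP[/gs|/gt].
  by move=> u [gu stu]; split; split => // C Cs; apply: stu; rewrite mem_cat Cs ?orbT.
have [|s gs sP] := cXX _ G (fun s xy => e <= mdist xy.1 xy.2 ->
    exists2 C, C \in s & C xy.1 /\ ~ C xy.2) GF.
  move=> [x y] _; have [xy|xy] := pselect (x = y).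
    have e20 : 0 < e / 2 by rewrite divr_gt0.
    exists ([set z : X * X | mdist x z.1 < e / 2 /\ mdist x z.2 < e / 2], setT).
      split => /=; last exact: filterT.
      exists ([set z | mdist x z < e / 2], [set z | mdist x z < e / 2]).
        by split; [exact: mdist_nbhs|rewrite /= -xy; exact: mdist_nbhs].
      by move=> [z w].
    move=> [[z w] s] /= [[xz xw] _]; rewrite leNgt => /negP; case.
    by have := metric_triangle z x w; rewrite (metric_sym z x); lra.
  have [C [r [sC Cx nCr oD Dy]]] := dendrite_separation dX xy.
  exists (C `*` ~` (C `|` [set r]), [set t | good t /\ {subset [:: C] <= t}]).
    split => /=; last by exists [:: C] => // D; rewrite inE => /eqP ->.
    exists (C, ~` (C `|` [set r])) => //; split; apply: open_nbhs_nbhs => //.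
    by split => //; case: sC.
  move=> [[z w] t] /= [[Cz nCw] [_ Ct]] _; exists C; first by apply: Ct; rewrite inE.
  by split => // Cw; apply: nCw; left.
exists s; split => // x y exy.
by apply: (sP s (conj gs (fun _ => id)) (x, y) I exy).
Qed.

End halfspaces.

Lemma halfspace_preimage (T : topologicalType) (f : T -> T) (C : set T)
    (k : nat) :
  continuous f -> monotone_map f -> halfspace C ->
  halfspace (iter k f @^-1` C).
Proof.
move=> cf mf sC; elim: k => // k [oC cC cnC].
have -> : iter k.+1 f @^-1` C = f @^-1` (iter k f @^-1` C).
  by apply/seteqP; split => x; rewrite /preimage/= -iterSr -iterS.
split; [by move/continuousP : cf; apply|exact: mf|].
exact: (mf (~` (iter k f @^-1` C))).
Qed.

(** * Noncrossing families *)

(* If no lag misses a pattern [(b, ~~ b)], every lag misses [(true, true)] or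
   [(false, false)]; lags [q1], [q2] of the two kinds make [q1 + q2] a
   period. *)
Lemma missing_patterns_periodic (u : nat -> bool) :
  (forall q, (0 < q)%N ->
     exists a b, forall k, ~ (u k = a /\ u (k + q)%N = b)) ->
  exists m K, (0 < m)%N /\ forall k, (K <= k)%N -> u (k + m)%N = u k.
Proof.
move=> missing.
have [[q [b [q0 uq]]]|nmono] := pselect (exists q b, (0 < q)%N /\
    forall k, u k = b -> u (k + q)%N = b).
  (* Along each residue class modulo [q] the value [b] persists once reached; [j i] is a step at
     which it is reached, if ever. A class that never reaches [b] is constantly the other value. *)
  have /choice[j jP] i : exists j,
      u (i + j * q)%N = b \/ forall j, u (i + j * q)%N <> b.
    have [[j uj]|nj] := pselect (exists j, u (i + j * q)%N = b).
      by exists j; left.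
    by exists 0%N; right => j' uj'; apply: nj; exists j'.
  have stay i t : u i = b -> u (i + t * q)%N = b.
    by move=> ui; elim: t => [|t IH]; rewrite ?addn0// mulSn addnCA addnC; exact: uq.
  exists q, ((\max_(i < q) j i).+1 * q)%N; split => // k Kk.
  pose i := (k %% q)%N; have iq : (i < q)%N by rewrite ltn_pmod.
  have kE : k = (i + k %/ q * q)%N by rewrite [LHS](divn_eq k q) addnC.
  have jk : (j i <= k %/ q)%N.
    apply: (@leq_trans (\max_(i < q) j i)); first exact: (leq_bigmax (Ordinal iq)).
    by rewrite leq_divRL// (leq_trans _ Kk)// leq_mul2r leqnSn orbT.
  case: (jP i) => [uj|nuj].
    have uk : u k = b.
      by rewrite kE -(subnKC jk) mulnDl addnA stay.
    by rewrite uk; exact: uq.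
  have nk := nuj (k %/ q)%N; rewrite -kE in nk.
  have nkq := nuj (k %/ q).+1; rewrite mulSn addnCA -kE addnC in nkq.
  by case: (u k) (u (k + q)%N) b nk nkq {uq jP stay nuj} => -[] [].
have {}missing q : (0 < q)%N -> exists a, forall k, u k = a -> u (k + q)%N = ~~ a.
  move=> q0; have [a [b ab]] := missing _ q0; exists a => k uk.
  have [abE|ab'] := eqVneq a b.
    by case: (u (k + q)%N) (ab k) => H; case: a {ab} abE uk H => <- uk H //;
      exfalso; exact: H.
  exfalso; apply: nmono; exists q, a; split => // i ui.
  by case: (u (i + q)%N) (ab i) => H; case: a b ab' {ab uk} ui H => -[]//= _ ui H;
    exfalso; exact: H.
have [[q1 [q10 u1]]|n1] := pselect (exists q, (0 < q)%N /\
    forall k, u k = false -> u (k + q)%N = true).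
- have [[q2 [q20 u2]]|n2] := pselect (exists q, (0 < q)%N /\
      forall k, u k = true -> u (k + q)%N = false).
    exists (q1 + q2)%N, 0%N; split => [|k _]; first by rewrite addn_gt0 q10.
    case uk : (u k); first by rewrite [(q1 + q2)%N]addnC addnA u1// u2.
    by rewrite addnA u2// u1.
  (* Here every lag misses [(false, false)], so one value [false] makes all later values [true]. *)
  have uF q k : (0 < q)%N -> u k = false -> u (k + q)%N = true.
    move=> q0 uk; have [[] aP] := missing _ q0; last exact: aP.
    by exfalso; apply: n2; exists q.
  have [[k0 uk0]|nk] := pselect (exists k, u k = false).
    exists 1%N, k0.+1; split => // k k0k.
    have uT i : (k0 < i)%N -> u i = true.
      by move=> k0i; rewrite -(subnKC (ltnW k0i)) uF// subn_gt0.
    by rewrite !uT// (leq_trans k0k)// leq_addr.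
  exists 1%N, 0%N; split => // k _.
  have uT i : u i = true by case ui : (u i) => //; exfalso; apply: nk; exists i.
  by rewrite !uT.
- have uT q k : (0 < q)%N -> u k = true -> u (k + q)%N = false.
    move=> q0 uk; have [[] aP] := missing _ q0; first exact: aP.
    by exfalso; apply: n1; exists q.
  have [[k0 uk0]|nk] := pselect (exists k, u k = true).
    exists 1%N, k0.+1; split => // k k0k.
    have uF i : (k0 < i)%N -> u i = false.
      by move=> k0i; rewrite -(subnKC (ltnW k0i)) uT// subn_gt0.
    by rewrite !uF// (leq_trans k0k)// leq_addr.
  exists 1%N, 0%N; split => // k _.
  have uF i : u i = false by case ui : (u i) => //; exfalso; apply: nk; exists i.
  by rewrite !uF.
Qed.

Lemma period_muln (u : nat -> bool) (m K : nat) :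
  (forall k, (K <= k)%N -> u (k + m)%N = u k) ->
  forall j k, (K <= k)%N -> u (k + j * m)%N = u k.
Proof.
move=> um; elim=> [|j IH] k Kk; first by rewrite addn0.
by rewrite mulSn addnA IH ?um// (leq_trans Kk)// leq_addr.
Qed.

Lemma common_period (I : eqType) (s : seq I) (u : I -> nat -> bool) :
  (forall i, i \in s -> exists m K, (0 < m)%N /\
     forall k, (K <= k)%N -> u i (k + m)%N = u i k) ->
  exists m K, (0 < m)%N /\ forall i, i \in s ->
     forall k, (K <= k)%N -> u i (k + m)%N = u i k.
Proof.
elim: s => [|i s IH] us; first by exists 1%N, 0%N.
have [|m [K [m0 mK]]] := IH; first by move=> j js; apply: us; rewrite inE js orbT.
have [|m' [K' [m0' mK']]] := us i; first by rewrite inE eqxx.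
exists (m * m')%N, (maxn K K'); split=> [|j]; first by rewrite muln_gt0 m0.
rewrite inE => /predU1P[->|js] k; rewrite geq_max => /andP[Kk K'k].
  by rewrite (period_muln mK').
by rewrite mulnC (period_muln (mK _ js)).
Qed.

Definition apart (T : Type) (s : seq (set T)) (x y : T) : bool :=
  has (fun C => (x \in C) != (y \in C)) s.

(** [A] splits each of the two pairs and [C] tells the pairs apart, so the four points occupy the
    four intersections. *)
Lemma crossing_of (T : Type) (A C : set T) (a b x y : T) :
  (a \in A) != (b \in A) -> (x \in A) != (y \in A) ->
  (a \in C) = (b \in C) -> (x \in C) = (y \in C) ->
  (a \in C) != (x \in C) -> crossing A C.
Proof.
have inN (D : set T) z : z \notin D -> (~` D) z.
  by move=> /negP nD Dz; apply: nD; rewrite inE.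
wlog : a b x y / (a \in C) && (x \notin C) => [hw abA xyA abC xyC|].
  case aC : (a \in C); case xC : (x \in C) => // _.
    by apply: (hw a b x y) => //; rewrite ?aC ?xC.
  by apply: (hw x y a b) => //; rewrite ?aC ?xC.
wlog : a b / (a \in A) && (b \notin A) => [hw aCx abA xyA abC xyC ne|].
  case aA : (a \in A) abA; case bA : (b \in A) => // _.
    by apply: (hw a b) => //; rewrite ?aA ?bA.
  by apply: (hw b a) => //; rewrite -?abC ?aA ?bA.
wlog : x y / (x \in A) && (y \notin A) => [hw abA aCx abA' xyA abC xyC ne|].
  case xA : (x \in A) xyA; case yA : (y \in A) => // _.
    by apply: (hw x y) => //; rewrite ?xA ?yA.
  by apply: (hw y x) => //; rewrite -?xyC ?xA ?yA.
move=> /andP[xA yA] /andP[aA bA] /andP[aC xC] _ _ abC xyC _.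
have bC := aC; rewrite abC in bC; have yC := xC; rewrite xyC in yC.
split; [exists a|exists x|exists b|exists y]; split;
  by [exact: set_mem|exact: inN].
Qed.

(** Dropping one set [A] merges at most one pair of points. If only [A] separates [x, y] and also
    [a, b], then noncrossing forces [a], [b], [x] to agree on all other sets, so [A] would have to
    tell three points apart. Removing [x] therefore restores separation. *)
Lemma noncrossing_count (T : eqType) (s : seq (set T)) (E : seq T) :
  (forall C D, C \in s -> D \in s -> ~ crossing C D) -> uniq E ->
  (forall x y, x \in E -> y \in E -> x != y -> apart s x y) ->
  (size E <= (size s).+1)%N.
Proof.
elim: s E => [|A s IH] E nc uE apE.
  case: E uE apE => [//|x [//|y E]] /= /andP[]; rewrite inE negb_or => /andP[xy _] _.
  by move=> /(_ x y); rewrite !inE !eqxx !orbT => /(_ isT isT xy).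
have ncs C D : C \in s -> D \in s -> ~ crossing C D.
  by move=> Cs Ds; apply: nc; rewrite inE ?Cs ?Ds orbT.
have [[x [y [xE yE xy nxy]]]|all_ap] := pselect (exists x y,
    [/\ x \in E, y \in E, x != y & ~~ apart s x y]); last first.
  apply: leqW; apply: IH => // x y xE yE xy.
  by apply: contrapT => /negP nxy; apply: all_ap; exists x, y.
have xyA : (x \in A) != (y \in A).
  have := apE _ _ xE yE xy; rewrite /apart/= => /orP[//|].
  by rewrite -/(apart s x y) (negbTE nxy).
rewrite (perm_size (perm_to_rem xE))/= ltnS; apply: IH => //; first exact: rem_uniq.
move=> a b; rewrite !mem_rem_uniq// !inE => /andP[ax aE] /andP[bx bE] ab.
apply: contrapT => /negP nab.
have same z w C : ~~ apart s z w -> C \in s -> (z \in C) = (w \in C).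
  by move=> /hasPn H /H; rewrite negbK => /eqP.
have inA z w : z \in E -> w \in E -> z != w -> ~~ apart s z w -> (z \in A) != (w \in A).
  move=> zE wE zw nzw; have := apE _ _ zE wE zw.
  by rewrite /apart/= => /orP[//|]; rewrite -/(apart s z w) (negbTE nzw).
have abA := inA _ _ aE bE ab nab.
have nax : ~~ apart s a x.
  apply/hasPn => C Cs; apply/negP => aCx.
  apply: (nc A C); rewrite ?inE ?eqxx ?Cs ?orbT//.
  exact: (crossing_of abA xyA (same _ _ _ nab Cs) (same _ _ _ nxy Cs) aCx).
have nbx : ~~ apart s b x.
  apply/hasPn => C Cs; rewrite negbK -(same _ _ _ nab Cs).
  by apply/eqP; exact: same nax Cs.
have := inA _ _ aE xE ax nax; have := inA _ _ bE xE bx nbx.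
by case: (a \in A) (b \in A) (x \in A) abA => -[] [].
Qed.

Definition memcode (T : Type) (s : seq (set T)) (x : T) : (size s).-tuple bool :=
  map_tuple (fun C => x \in C) (in_tuple s).

Lemma memcodeP (T : Type) (s : seq (set T)) (x y : T) :
  (memcode s x == memcode s y) = ~~ apart s x y.
Proof.
rewrite -val_eqE /= /apart; elim: s => //= C s IH.
by rewrite eqseq_cons IH negb_or negbK.
Qed.

Lemma card_memcode (T : eqType) (s : seq (set T)) :
  (forall C D, C \in s -> D \in s -> ~ crossing C D) ->
  (#|[set c : (size s).-tuple bool | `[< exists x, memcode s x = c >]]%SET| <=
   (size s).+1)%N.
Proof.
move=> nc; set Img := [set c | _]%SET.
have [->|[c0 c0I]] := set_0Vmem Img; first by rewrite cards0.
have [x0 _] : exists x, memcode s x = c0 by move: c0I; rewrite inE => /asboolP.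
have /choice[r rP] c : exists x, c \in Img -> memcode s x = c.
  have [|_] := boolP (c \in Img); last by exists x0.
  by rewrite inE => /asboolP[x xc]; exists x.
have rK : {in Img, cancel r (memcode s)} by move=> c /rP.
rewrite cardE -(size_map r); apply: noncrossing_count => //.
  rewrite map_inj_in_uniq ?enum_uniq// => c d; rewrite !mem_enum => cI dI cd.
  by rewrite -(rK _ cI) -(rK _ dI) cd.
move=> x y /mapP[c]; rewrite mem_enum => cI -> /mapP[d]; rewrite mem_enum => dI -> cd.
apply: contraNT cd; rewrite -memcodeP !rK//.
by move=> /eqP ->.
Qed.

(** * Dynamics *)

Lemma card_II_enum (T : choiceType) (A : set T) (k : nat) : (A #= `I_k)%card ->
  exists s : seq T, [/\ uniq s, size s = k & forall x, x \in s <-> A x].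
Proof.
move=> Ak; have finA : finite_set A by apply/finite_setP; exists k.
exists (finmap.enum_fset (fset_set A)); split.
- exact: finmap.fset_uniq.
- exact: card_fset_set.
- by move=> x; rewrite in_fset_set// inE.
Qed.

(** Listing with repetitions, smaller sets being padded by one of their points, gives all sets the
    same index type; their codes can then be counted as functions on ['I_n]. *)
Lemma fin_hyperspace_enum (T : choiceType) (n : nat) (A : fin_hyperspace T n) :
  exists g : {ffun 'I_n -> T}, forall x, fin_set A x <-> exists i, g i = x.
Proof.
have /finite_setP[k Ak] := fin_set_finite A.
have kn : (k <= n)%N.
  by have := fin_set_card A; rewrite (card_le_eql Ak) card_le_II.
have [s [us ssize sA]] := card_II_enum Ak.
have [a Aa] := fin_set_neq0 A.
exists [ffun i : 'I_n => nth a s i] => x; split=> [/sA xs|[i <-]].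
  have xn : (index x s < n)%N by rewrite (leq_trans _ kn)// -ssize index_mem.
  by exists (Ordinal xn); rewrite ffunE/= nth_index.
rewrite ffunE; have [ik|ki] := ltnP i (size s); last by rewrite nth_default.
by apply/sA; rewrite mem_nth.
Qed.

Lemma iter_fin_hyperspace_map (T : Type) (n : nat) (f : T -> T) (k : nat)
    (A : fin_hyperspace T n) :
  iter k (fin_hyperspace_map n f) A = iter k f @` A :> set T.
Proof.
elim: k => [|k IH] /=; first by rewrite image_id.
by rewrite IH image_comp.
Qed.

Lemma hausdorff_dist_iter_le (R : realType) (X : metricType R) (n : nat)
    (f : X -> X) (j k : nat) (A B : fin_hyperspace X n) (e : R) : 0 < e ->
  (forall a, fin_set A a -> exists2 b, fin_set B b &
    mdist (iter j f a) (iter k f b) < e) ->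
  (forall b, fin_set B b -> exists2 a, fin_set A a &
    mdist (iter j f a) (iter k f b) < e) ->
  mdist (iter j (fin_hyperspace_map n f) A)
    (iter k (fin_hyperspace_map n f) B) <= e.
Proof.
move=> e0 AB BA; rewrite fin_hyperspace_mdistE.
apply: hausdorff_dist_le => //; rewrite !iter_fin_hyperspace_map.
  move=> _ [a Aa <-]; have [b Bb ab] := AB _ Aa.
  by exists (iter k f b); [exists b|rewrite metric_sym].
move=> _ [b Bb <-]; have [a Aa ab] := BA _ Bb.
by exists (iter j f a); [exists a|].
Qed.

Lemma hausdorff_dist_iter_lt (R : realType) (X : metricType R) (n : nat)
    (f : X -> X) (k : nat) (A B : fin_hyperspace X n) (e : R) :
  mdist (iter k (fin_hyperspace_map n f) A)
    (iter k (fin_hyperspace_map n f) B) < e ->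
  (forall a, fin_set A a -> exists2 b, fin_set B b &
    mdist (iter k f a) (iter k f b) < e) /\
  (forall b, fin_set B b -> exists2 a, fin_set A a &
    mdist (iter k f a) (iter k f b) < e).
Proof.
rewrite fin_hyperspace_mdistE => /hausdorff_dist_lt.
rewrite !iter_fin_hyperspace_map => -[AB BA]; split=> [a Aa|b Bb].
  have [|_ [b Bb <-] ba] := AB (iter k f a); first by exists a.
  by exists b; rewrite // metric_sym.
have [|_ [a Aa <-] ab] := BA (iter k f b); first by exists b.
by exists a.
Qed.

Section monotone_dendrite_map.
Variables (R : realType) (X : metricType R) (f : X -> X).
Hypotheses (dX : dendrite X) (cf : continuous f) (mf : monotone_map f).

Lemma pullback_noncrossing (C D : set X) (i j : nat) :
  halfspace C -> halfspace D ->
  ~ crossing (iter i f @^-1` C) (iter j f @^-1` D).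
Proof.
by move=> sC sD; apply: (halfspace_noncrossing dX); exact: halfspace_preimage.
Qed.

Lemma itinerary_periodic (C : set X) (x : X) : halfspace C ->
  exists m K, (0 < m)%N /\
    forall k, (K <= k)%N -> (iter (k + m) f x \in C) = (iter k f x \in C).
Proof.
move=> sC; apply: (@missing_patterns_periodic (fun k => iter k f x \in C)).
move=> q q0; apply: contrapT => all_patterns.
have pat a b : exists k, (iter k f x \in C) = a /\ (iter (k + q) f x \in C) = b.
  apply: contrapT => nab; apply: all_patterns; exists a, b => k kab.
  by apply: nab; exists k.
have memE (D : set X) z : (z \in D) = false -> (~` D) z.
  by move=> zD Dz; rewrite (mem_set Dz) in zD.
have shift k : iter (k + q) f x = iter q f (iter k f x) by rewrite addnC iterD.
apply: (@pullback_noncrossing C C 0 q sC sC).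
have [k1 [a1 b1]] := pat true true; have [k2 [a2 b2]] := pat true false.
have [k3 [a3 b3]] := pat false true; have [k4 [a4 b4]] := pat false false.
rewrite !shift in b1 b2 b3 b4.
split; [exists (iter k1 f x)|exists (iter k2 f x)|exists (iter k3 f x)|
        exists (iter k4 f x)]; split; by [exact: set_mem|exact: memE].
Qed.

(** Finitely many itineraries matter, one for each point of [s] and each halfspace of an
    [e]-separating family. At times differing by multiples of their common period no such halfspace
    separates the positions. *)
Lemma orbits_almost_periodic (s : seq X) (e : R) : 0 < e ->
  exists m K, (0 < m)%N /\ forall x, x \in s -> forall k j, (K <= k)%N ->
    mdist (iter (k + j * m) f x) (iter k f x) < e.
Proof.
move=> e0; have [fam [famS famP]] := separating_halfspaces dX e0.
pose u (Cx : set X * X) k := iter k f Cx.2 \in Cx.1.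
have [|m [K [m0 mK]]] := @common_period _ [seq (C, x) | C <- fam, x <- s] u.
  move=> _ /allpairsP[[C x] [/= Cf xs ->]].
  by apply: itinerary_periodic; exact: famS.
exists m, K; split => // x xs k j Kk; rewrite ltNge; apply/negP.
move=> /famP[C Cfam [Ck nCk]]; apply: nCk.
have CxP : (C, x) \in [seq (C, x) | C <- fam, x <- s].
  by apply/allpairsP; exists (C, x).
have := @period_muln (u (C, x)) m K (mK _ CxP) j k Kk.
by rewrite /u/= (mem_set Ck) => /esym/set_mem.
Qed.

Lemma iter_equicontinuous (m : nat) (e : R) : 0 < e ->
  exists2 d, 0 < d & forall i x y, (i < m)%N -> mdist x y < d ->
    mdist (iter i f x) (iter i f y) < e.
Proof.
move=> e0; have [[_ /compact_near_coveringP cptX _] _ _] := dX.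
have unif i : exists2 d, 0 < d & forall x y, mdist x y < d ->
    mdist (iter i f x) (iter i f y) < e.
  have ci : continuous (iter i f).
    elim: i => [|i IH] x /=; first exact: cvg_id.
    by apply: continuous_comp; [exact: IH|exact: cf].
  have e20 : 0 < e / 2 by rewrite divr_gt0.
  (* Compactness along the filter of positive [d] tending to 0 makes the modulus of continuity
     uniform in [x]. *)
  have := cptX R 0^'+ (fun d x => forall y, mdist x y < d ->
    mdist (iter i f x) (iter i f y) < e) _.
  case=> [x _|d /= d0 dP].
  - have /metricType_numDomainType.cvgrPdist_lt/(_ _ e20)/nbhs_mdist[r r0 rP] := ci x.
    have r20 : 0 < r / 2 by rewrite divr_gt0.
    exists ([set y | mdist x y < r / 2], [set d | d < r / 2]) => /=.
      by split; [exact: mdist_nbhs|exact: nbhs_right_lt].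
    move=> [y d] /= [xy dr] z yz.
    have /rP /= xy' : mdist x y < r by lra.
    have /rP /= xz' : mdist x z < r by have := metric_triangle x y z; lra.
    have := metric_triangle (iter i f y) (iter i f x) (iter i f z).
    by rewrite (metric_sym (iter i f y) (iter i f x)); lra.
  have d20 : 0 < d / 2 by rewrite divr_gt0.
  exists (d / 2) => // x y xy; apply: (dP (d / 2)) => //=.
  by rewrite sub0r normrN gtr0_norm// gtr_pMr// invf_lt1// ltr1n.
elim: m => [|m [d d0 dP]]; first by exists 1.
have [r r0 rP] := unif m; exists (Num.min d r); first by rewrite lt_min d0.
move=> i x y; rewrite ltnS leq_eqVlt lt_min => im /andP[xd xr].
by case/predU1P: im => [->|im]; [exact: rP|exact: dP].
Qed.

End monotone_dendrite_map.

(** * Proximality and entropy for the induced map *)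

Lemma limn_einf0_frequently (R : realType) (u : nat -> R) (e : R) (N : nat) :
  limn_einf (fun k => (u k)%:E) = 0%E -> 0 < e ->
  exists2 k, (N <= k)%N & u k < e.
Proof.
move=> u0 e0; apply: contrapT => nu.
suff : (e%:E <= limn_einf (fun k => (u k)%:E))%E.
  by rewrite u0 lee_fin leNgt e0.
rewrite limn_einf_lim (cvg_lim _ (@cvg_einfs_sup R _))//.
apply: le_trans (ereal_sup_ubound _); last by exists N.
apply: le_ereal_inf_tmp => _ [k /= Nk <-]; rewrite lee_fin leNgt.
by apply/negP => uk; apply: nu; exists k.
Qed.

Lemma limn_esup_eq0 (R : realType) (u : nat -> \bar R) :
  (forall e, 0 < e -> exists K, forall k, (K <= k)%N ->
     (0 <= u k)%E /\ (u k <= e%:E)%E) ->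
  limn_esup u = 0%E.
Proof.
move=> u0; rewrite limn_esup_lim (cvg_lim _ (@cvg_esups_inf R _))//.
apply/eqP; rewrite eq_le; apply/andP; split.
  apply/lee_addgt0Pr => e e0; rewrite add0e; have [K uK] := u0 _ e0.
  apply: (@le_trans _ _ (esups u K)); first by apply: ereal_inf_lbound; exists K.
  by apply: ge_ereal_sup => _ [k /= Kk <-]; have [] := uK _ Kk.
apply: le_ereal_inf_tmp => _ [N _ <-]; have [K uK] := u0 1 ltr01.
have [u1 _] := uK (maxn N K) (leq_maxr _ _).
apply: le_trans u1 _; apply: ereal_sup_ubound.
by exists (maxn N K) => //=; exact: leq_maxl.
Qed.

Section induced_map.
Variables (R : realType) (X : metricType R) (f : X -> X) (n : nat).
Hypotheses (dX : dendrite X) (cf : continuous f) (mf : monotone_map f).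

(** Let [m] be a common [e / 3]-period of all orbits involved from time [K] on, and let
    [d]-closeness survive, up to [e / 3], the first [m] iterates. Points that are [d]-close at a
    time [l >= K] are then [e]-close at every [k >= l]: shift [k] by multiples of [m] to a time in
    [[l, l + m[] and use the triangle inequality. *)
Lemma proximal_asymptotic (A B : fin_hyperspace X n) :
  proximal_pair (fin_hyperspace_map n f) A B ->
  asymptotic_pair (fin_hyperspace_map n f) A B.
Proof.
move=> AB; apply: limn_esup_eq0 => e e0.
have /finite_seqP[sA AE] := fin_set_finite A.
have /finite_seqP[sB BE] := fin_set_finite B.
have e30 : 0 < e / 3 by rewrite divr_gt0.
have [m [K [m0 mK]]] := orbits_almost_periodic dX cf mf (sA ++ sB) e30.
have [d d0 dP] := iter_equicontinuous dX cf m e30.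
have [l Kl /hausdorff_dist_iter_lt[ABl BAl]] := limn_einf0_frequently K AB d0.
exists l => k lk; split; first by rewrite lee_fin mdist_ge0.
have close a b : a \in sA -> b \in sB ->
    mdist (iter l f a) (iter l f b) < d -> mdist (iter k f a) (iter k f b) < e.
  move=> aA bB ab; pose i := ((k - l) %% m)%N.
  have im : (i < m)%N by rewrite ltn_pmod.
  have kE : k = (l + i + (k - l) %/ m * m)%N.
    by rewrite -addnA [(i + _)%N]addnC -divn_eq subnKC.
  have Ki : (K <= l + i)%N by rewrite (leq_trans Kl)// leq_addr.
  have := mK a _ (l + i)%N ((k - l) %/ m)%N Ki.
  have := mK b _ (l + i)%N ((k - l) %/ m)%N Ki.
  rewrite -kE !mem_cat aA bB orbT => /(_ isT) kb /(_ isT) ka.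
  have := dP i _ _ im ab; rewrite -!iterD [(i + l)%N]addnC => kab.
  have t1 := metric_triangle (iter k f a) (iter (l + i) f a) (iter k f b).
  have t2 := metric_triangle (iter (l + i) f a) (iter (l + i) f b) (iter k f b).
  by rewrite metric_sym in kb; lra.
rewrite lee_fin; apply: hausdorff_dist_iter_le => // [a Aa|b Bb].
  have [b Bb ab] := ABl _ Aa; exists b => //; apply: close ab.
    by move: Aa; rewrite AE.
  by move: Bb; rewrite BE.
have [a Aa ab] := BAl _ Bb; exists a => //; apply: close ab.
  by move: Aa; rewrite AE.
by move: Bb; rewrite BE.
Qed.

(** Each set is coded by the codes of its listed points with respect to the preimages of [fam] under
    the first [m] iterates. Sets with equal codes stay within [e] of each other for [m] steps, so
    [E] injects into the codes; since the preimages do not cross, a point has at most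
    [(m * size fam).+1] of them. *)
Lemma separated_card (fam : seq (set X)) (m k : nat) (e : R)
    (E : set (fin_hyperspace X n)) : 0 < e ->
  (forall C, C \in fam -> halfspace C) ->
  (forall x y, e <= mdist x y -> exists2 C, C \in fam & C x /\ ~ C y) ->
  separated_set (fin_hyperspace_map n f) m e E -> (E #= `I_k)%card ->
  (k <= (m * size fam).+1 ^ n)%N.
Proof.
move=> e0 famH famP sepE /card_II_enum[s [us <- sE]].
pose pb := [seq iter i f @^-1` C | i <- iota 0 m, C <- fam].
have pb_nc C D : C \in pb -> D \in pb -> ~ crossing C D.
  move=> /allpairsP[[i C'] [/= _ Cf ->]] /allpairsP[[j D'] [/= _ Df ->]].
  by apply: pullback_noncrossing => //; exact: famH.
have <- : size pb = (m * size fam)%N by rewrite size_allpairs size_iota.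
have := card_memcode pb_nc.
set Img := [set c | _]%SET => cardImg.
have /choice[G GP] (A : fin_hyperspace X n) :
    exists g : {ffun 'I_n -> X}, forall x, fin_set A x <-> exists i, g i = x.
  exact: fin_hyperspace_enum.
pose Psi A := [ffun i => memcode pb (G A i)].
have close a b j : (j < m)%N -> memcode pb a = memcode pb b ->
    mdist (iter j f a) (iter j f b) < e.
  move=> jm /eqP; rewrite memcodeP => nab.
  rewrite ltNge; apply/negP => /famP[C Cf [Ca nCb]].
  have Cpb : iter j f @^-1` C \in pb.
    by apply/allpairsP; exists (j, C); rewrite mem_iota.
  have := hasPn nab _ Cpb; rewrite negbK mem_set// => /eqP/esym.
  by move=> /set_mem.
have Psi_inj : {in s &, injective Psi}.
  move=> A B /sE EA /sE EB ABPsi; apply: contrapT => AB.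
  have [j jm] := sepE _ _ EA EB AB; rewrite ltNge => /negP; apply.
  have PsiE i : memcode pb (G A i) = memcode pb (G B i).
    by move/ffunP/(_ i) : ABPsi; rewrite !ffunE.
  apply: hausdorff_dist_iter_le => // [a /GP[i <-]|b /GP[i <-]].
    by exists (G B i); [apply/GP; exists i|exact: close].
  by exists (G A i); [apply/GP; exists i|exact: close].
have uPsi : uniq (map Psi s) by rewrite map_inj_in_uniq.
apply: (@leq_trans #|ffun_on (mem Img) : {pred {ffun 'I_n -> _}}|); last first.
  rewrite card_ffun_on card_ord; have [->|n0] := posnP n; first by rewrite !expn0.
  by rewrite leq_exp2r.
rewrite -(size_map Psi) -(card_uniqP uPsi); apply: subset_leq_card.
apply/fintype.subsetP => _ /mapP[A _ ->]; apply/ffun_onP => i.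
by rewrite ffunE inE; apply/asboolP; exists (G A i).
Qed.

Lemma entropy_at_scale_eq0 (e : R) : 0 < e -> (0 < n)%N ->
  entropy_at_scale (fin_hyperspace_map n f) e = 0%E.
Proof.
move=> e0 n0; have [fam [famH famP]] := separating_halfspaces dX e0.
pose N := size fam.
have sep_le m : (max_separated (fin_hyperspace_map n f) m e <=
    (((m * N).+1 ^ n)%:R)%:E)%E.
  apply: ge_ereal_sup => _ [k [E sepE Ek] <-].
  by rewrite lee_fin ler_nat; exact: separated_card sepE Ek.
(* A singleton is always separated, so the logarithm below is nonnegative. *)
have sep_ge m : (1 <= max_separated (fin_hyperspace_map n f) m e)%E.
  have [[[x _] _ _] _ _] := dX.
  have xn : ([set x] #<= `I_n)%card.
    by rewrite (card_le_eql card_set1) card_le_II.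
  pose x' := FinHyperspace (ex_intro _ x (erefl x) : [set x] !=set0) xn.
  apply: ereal_sup_ubound; exists 1%N => //; exists [set x']; last exact: card_set1.
  by move=> _ _ -> -> /(_ erefl).
apply: limn_esup_eq0 => r r0.
have N1 : 0 < N.+1%:R :> R by rewrite ltr0n.
have n1 : 0 < n%:R :> R by rewrite ltr0n.
(* Chosen so that [n * d * m * (N + 1)] is [r / 2 * m]; the other half of [r * m] absorbs the
   constant [- n * ln d] once [m] is large. *)
pose d : R := r / 2 / n%:R / N.+1%:R.
have d0 : 0 < d by rewrite !divr_gt0.
have [K _ KP] := nbhs_infty_ger (- (n%:R * ln d) * 2 / r).
exists K.+1 => m Km.
have m0 : 0 < m%:R :> R by rewrite ltr0n; exact: leq_trans Km.
have lne_ge0m : (0 <= lne (max_separated (fin_hyperspace_map n f) m e))%E.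
  by rewrite lne_ge0.
split; first by rewrite mule_ge0// lee_fin invr_ge0 ltW.
have y0 : 0 < (m * N).+1%:R :> R by rewrite ltr0n.
(* The bound of [ln] by the identity, applied at [d * y] rather than [y], gives linear growth of
   arbitrarily small slope. *)
have lny : ln ((m * N).+1%:R : R) <= d * (m * N).+1%:R - ln d.
  have := ln_sublinear (mulr_gt0 d0 y0); rewrite lnM ?posrE//; lra.
have lnyn : n%:R * ln ((m * N).+1%:R : R) <= r * m%:R.
  apply: (@le_trans _ _ (n%:R * (d * (m * N.+1)%:R - ln d))).
    rewrite ler_pM2l// (le_trans lny)// lerB// ler_pM2l// ler_nat.
    by rewrite mulnS addnC -addn1 leq_add2l; exact: leq_trans Km.
  rewrite natrM mulrBr.
  have -> : n%:R * (d * (m%:R * N.+1%:R)) = r / 2 * m%:R.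
    have dE : d * N.+1%:R = r / 2 / n%:R by rewrite divfK ?gt_eqF.
    rewrite [d * _]mulrCA dE mulrCA [n%:R * _]mulrCA divff ?gt_eqF// mulr1.
    exact: mulrC.
  have := KP m (ltnW Km); rewrite /= ler_pdivrMr//; lra.
apply: (@le_trans _ _ ((m%:R^-1)%:E * (r * m%:R)%:E)%E); last first.
  by rewrite -EFinM lee_fin mulrCA mulVf ?mulr1// gt_eqF.
apply: lee_wpmul2l; first by rewrite lee_fin invr_ge0 ltW.
apply: (@le_trans _ _ (lne (((m * N).+1 ^ n)%:R : R)%:E)).
  by rewrite lee_lne ?sep_le// in_itv/= leey ?lee_fin ?ler0n ?max_separated_ge0.
rewrite lne_EFin ?ltr0n ?expn_gt0// lee_fin natrX lnXn//.
by rewrite -[leLHS]mulr_natl.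
Qed.

End induced_map.

Theorem corollary5p6 (R : realType) (X : metricType R) (f : X -> X) (n : nat)
  (dendX : dendrite X) (cf : continuous f) (mf : monotone_map f)
  (n_gt0 : (0 < n)%N) :
  (forall A B : fin_hyperspace X n,
      ~ li_yorke_pair (fin_hyperspace_map n f) A B) /\
  topological_entropy (fin_hyperspace_map n f) = 0%E.
Proof.
split=> [A B [prox nasym]|].
  exact/nasym/(proximal_asymptotic dendX cf mf).
apply: cvg_lim => //; apply: cvg_near_cst.
near=> e; apply: (entropy_at_scale_eq0 dendX cf mf) => //.
Unshelve. all: by end_near. Qed.
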